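(* Let $G=\langle s_1,\ldots,s_r\rangle$ be a free group or free semigroup of rank $r\ge 1$, let $T=(T_g)_{g\in G}$ be a measure-preserving action of $G$ on a standard probability space $(X,\mu)$, and let $\phi:X\to A$ be a finite observable. For $i\ge 1$ let $\mu_i$ be the uniform probability measure on the set of all homomorphisms from $G$ to $\mathrm{Sym}(i)$, and let $\Sigma=\{\mu_i\}_{i=1}^\infty$. Then $$h(\Sigma,T,\phi)=f(T,\phi).$$
   Context: Semigroups have an identity element $e$ (so a free semigroup of rank $r$ is the free monoid on $s_1,\dots,s_r$), and homomorphisms and actions respect the identity. $\mathrm{Sym}(n)$ is the symmetric group of $\{1,\ldots,n\}$. A measure-preserving action $T=(T_g)_{g\in G}$ of $G$ on $(X,\mu)$ consists of measure-preserving maps $T_g:X\to X$ with $T_{g_1}T_{g_2}=T_{g_1g_2}$. A finite observable is a measurable map $\phi:X\to A$ with $A$ a finite set. **$\Sigma$-entropy rate.** For finite $H\subset G$ let $\phi^H:X\to A^H$ be $\phi^H(x)=(\phi(T_hx))_{h\in H}$, and let $\phi^H_*\mu$ be the pushforward of $\mu$ to $A^H$. Given a homomorphism $\sigma:G\to\mathrm{Sym}(n)$ and a map $\psi:\{1,\ldots,n\}\to A$, let $\psi^H:\{1,\dots,n\}\to A^H$ be $\psi^H(j)=(\psi(\sigma(h)j))_{h\in H}$, and let $\psi^H_*\zeta$ be the pushforward of the uniform probability measure $\zeta$ on $\{1,\dots,n\}$. Put $$d^H_{\sigma}(\phi,\psi)=\sum_{a\in A^H}\big|\phi^H_*\mu(a)-\psi^H_*\zeta(a)\big|.$$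 For $\Sigma=\{\mu_i\}_{i\ge1}$ with $\mu_i$ a probability measure on the set of homomorphisms $G\to\mathrm{Sym}(i)$, let $\sigma_i$ be random with law $\mu_i$ and define $$h(\Sigma,T,\phi):=\inf_{H\subset G}\ \inf_{\epsilon>0}\ \limsup_{i\to\infty}\frac1i\log\Big(\mathbb E\Big[\big|\{\psi:\{1,\ldots,i\}\to A:\ d^H_{\sigma_i}(\phi,\psi)\le\epsilon\}\big|\Big]\Big),$$ where the first infimum is over all finite subsets $H\subset G$ and $\mathbb E$ is expectation over $\sigma_i$ (with $\log 0=-\infty$). **$f$-invariant.** For a countable measurable partition $\alpha$ of $X$, $H(\alpha)=-\sum_{P\in\alpha}\mu(P)\log\mu(P)$ (with $0\log 0=0$), and $\alpha\vee\beta=\{P\cap Q: P\in\alpha,Q\in\beta\}$. Let $B(e,n)$ be the ball of radius $n$ around $e$ in $G$ for the word metric of the generating set ($\{s_1^{\pm1},\ldots,s_r^{\pm1}\}$ if $G$ is a group, $\{s_1,\ldots,s_r\}$ if $G$ is a semigroup). Define $$F(T,\alpha)=(1-2r)H(\alpha)+\sum_{i=1}^rH(\alpha\vee T_{s_i}^{-1}\alpha),\qquad \alpha^n=\bigvee_{g\in B(e,n)}T_g^{-1}\alpha,\qquad f(T,\alpha)=\inf_nF(T,\alpha^n).$$ For an observable $\phi:X\to A$, let $\bar\phi=\{\phi^{-1}(a)\}_{a\in A}$ and $f(T,\phi):=f(T,\bar\phi)$. *)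

(* Defs.v *)
From HB Require Import structures.
From mathcomp Require Import all_boot all_order all_algebra all_fingroup.
From mathcomp Require Import finmap.
From mathcomp Require Import all_classical all_reals all_analysis.

Set Implicit Arguments.
Unset Strict Implicit.
Unset Printing Implicit Defensive.

Import Order.TTheory GRing.Theory Num.Theory.
Import numFieldNormedType.Exports.

Local Open Scope classical_set_scope.
Local Open Scope ring_scope.

(* A free semigroup has an identity: it is the free monoid on its generators. *)
Definition free_semigroup_on (r : nat) (G : monoidType) (s : 'I_r -> G) :=
  forall g : G, exists! w : seq 'I_r, (\prod_(i <- w) s i)%g = g.

(* The letter (i, b) stands for s_i if b = true and for s_i^-1 if b = false. *)
Definition letter (r : nat) (G : groupType) (s : 'I_r -> G) (x : 'I_r * bool) : G :=
  (if x.2 then s x.1 else (s x.1)^-1)%g.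

Definition reduced (r : nat) (w : seq ('I_r * bool)) : bool :=
  sorted (fun x y => y != (x.1, ~~ x.2)) w.

Definition free_group_on (r : nat) (G : groupType) (s : 'I_r -> G) :=
  forall g : G, exists! w : seq ('I_r * bool),
    reduced w /\ (\prod_(x <- w) letter s x)%g = g.

Definition semigroup_generators (r : nat) (G : monoidType) (s : 'I_r -> G) : set G :=
  [set g | exists i, g = s i].

Definition group_generators (r : nat) (G : groupType) (s : 'I_r -> G) : set G :=
  [set g | exists i, g = s i \/ g = (s i)^-1%g].

(* Elements at word distance at most n from the identity. *)
Definition word_ball (G : monoidType) (S : set G) (n : nat) : set G :=
  [set g | exists w : seq G,
     [/\ (size w <= n)%N, forall x, x \in w -> S x & (\prod_(x <- w) x)%g = g]].

(* Isomorphism mod 0 with a Borel probability measure on a Polish space.  The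
   sandwich B1 <= f(E) <= B2 allows the sigma-algebra of X to be anything between
   the Borel sigma-algebra and its completion, so that both Polish spaces with
   their Borel sets and Lebesgue-Rokhlin spaces are standard. *)
Definition standard_probability_space (R : realType) (d : measure_display)
    (X : measurableType d) (mu : probability X R) : Prop :=
  exists (P : completePseudoMetricType R) (f : X -> P) (X0 : set X),
  [/\ hausdorff_space P /\ @second_countable P,
      measurable X0 /\ mu X0 = 1%E,
      forall x y, X0 x -> X0 y -> f x = f y -> x = y,
      forall U : set P, open U -> measurable (f @^-1` U) &
      forall E, measurable E -> E `<=` X0 ->
        exists B1 B2 : set P,
        [/\ <<s [set U | open U] >> B1, <<s [set U | open U] >> B2,
            B1 `<=` f @` E, f @` E `<=` B2 & mu (f @^-1` (B2 `\` B1)) = 0%E]].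

Definition mp_action (R : realType) (d : measure_display) (X : measurableType d)
    (mu : probability X R) (G : monoidType) (T : G -> X -> X) : Prop :=
  [/\ forall x, T 1%g x = x,
      forall g h x, T (g * h)%g x = T g (T h x),
      forall g, measurable_fun [set: X] (T g) &
      forall g E, measurable E -> mu (T g @^-1` E) = mu E].

Definition finite_observable (d : measure_display) (X : measurableType d)
    (A : finType) (phi : X -> A) : Prop :=
  forall B : set A, measurable (phi @^-1` B).

(* Homomorphisms G -> Sym(n).  They are spelled out because the product of
   permutations in MathComp is composition in the opposite order. *)
Definition sym_homs (G : monoidType) (n : nat) : set (G -> 'S_n) :=
  [set sigma | (forall j, sigma 1%g j = j) /\
     (forall g h j, sigma (g * h)%g j = sigma g (sigma h j))].
Arguments sym_homs : clear implicits.

Definition obs_name (X : Type) (G : monoidType) (A : finType) (T : G -> X -> X)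
    (phi : X -> A) (H : {fset G}) (x : X) : {ffun H -> A} :=
  [ffun h : H => phi (T (val h) x)].

Definition perm_name (G : monoidType) (A : finType) (n : nat) (sigma : G -> 'S_n)
    (psi : 'I_n -> A) (H : {fset G}) (j : 'I_n) : {ffun H -> A} :=
  [ffun h : H => psi (sigma (val h) j)].

Definition name_dist (R : realType) (d : measure_display) (X : measurableType d)
    (mu : probability X R) (G : monoidType) (T : G -> X -> X) (A : finType)
    (phi : X -> A) (H : {fset G}) (n : nat) (sigma : G -> 'S_n)
    (psi : 'I_n -> A) : R :=
  \sum_(a : {ffun H -> A})
    `| fine (mu (obs_name T phi H @^-1` [set a]))
       - #|[pred j | perm_name sigma psi H j == a]|%:R / n%:R |.

Definition good_count (R : realType) (d : measure_display) (X : measurableType d)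
    (mu : probability X R) (G : monoidType) (T : G -> X -> X) (A : finType)
    (phi : X -> A) (H : {fset G}) (eps : R) (n : nat) (sigma : G -> 'S_n) : nat :=
  #|[pred psi : {ffun 'I_n -> A} | name_dist mu T phi H sigma psi <= eps]|.

(* A probability measure on the homomorphisms G -> Sym(i) is given by its mass
   function: Sigma i sigma is mu_i({sigma}). *)
Definition Sigma_entropy (R : realType) (d : measure_display) (X : measurableType d)
    (mu : probability X R) (G : monoidType) (Sigma : forall i, (G -> 'S_i) -> R)
    (T : G -> X -> X) (A : finType) (phi : X -> A) : \bar R :=
  ereal_inf [set ereal_inf
    [set limn_esup (fun i : nat =>
       ((i%:R^-1)%:E *
        lne (\esum_(sigma in sym_homs G i)
               (Sigma i sigma * (good_count mu T phi H eps sigma)%:R)%:E))%E)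
    | eps in [set eps : R | 0 < eps]] | H in [set: {fset G}]].

(* For finitely generated G the set sym_homs G i is finite. *)
Definition uniform_homs (R : realType) (G : monoidType) (i : nat)
    (sigma : G -> 'S_i) : R :=
  if sigma \in sym_homs G i then (#|` fset_set (sym_homs G i)|%:R)^-1 else 0.
Arguments uniform_homs : clear implicits.

Definition shannon (R : realType) (d : measure_display) (X : measurableType d)
    (mu : probability X R) (alpha : set (set X)) : \bar R :=
  (\esum_(P in alpha) (- (fine (mu P) * ln (fine (mu P))))%:E)%E.

Definition join (X : Type) (alpha beta : set (set X)) : set (set X) :=
  [set P `&` Q | P in alpha & Q in beta].

Definition pullback (X : Type) (t : X -> X) (alpha : set (set X)) : set (set X) :=
  [set t @^-1` P | P in alpha].

Definition bigjoin (X G : Type) (B : set G) (alpha : G -> set (set X)) : set (set X) :=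
  [set \bigcap_(g in B) P g | P in [set P : G -> set X | forall g, B g -> alpha g (P g)]].

Definition F_functional (R : realType) (d : measure_display) (X : measurableType d)
    (mu : probability X R) (r : nat) (G : monoidType) (s : 'I_r -> G)
    (T : G -> X -> X) (alpha : set (set X)) : \bar R :=
  ((1 - 2 * r%:R)%:E * shannon mu alpha
   + \sum_(i < r) shannon mu (join alpha (pullback (T (s i)) alpha)))%E.

Definition ball_refinement (X : Type) (G : monoidType) (S : set G)
    (T : G -> X -> X) (alpha : set (set X)) (n : nat) : set (set X) :=
  bigjoin (word_ball S n) (fun g => pullback (T g) alpha).

(* S is the generating set that defines the word metric. *)
Definition f_partition (R : realType) (d : measure_display) (X : measurableType d)
    (mu : probability X R) (r : nat) (G : monoidType) (s : 'I_r -> G) (S : set G)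
    (T : G -> X -> X) (alpha : set (set X)) : \bar R :=
  ereal_inf [set F_functional mu s T (ball_refinement S T alpha n) | n in [set: nat]].

Definition f_invariant (R : realType) (d : measure_display) (X : measurableType d)
    (mu : probability X R) (r : nat) (G : monoidType) (s : 'I_r -> G) (S : set G)
    (T : G -> X -> X) (A : finType) (phi : X -> A) : \bar R :=
  f_partition mu s S T [set phi @^-1` [set a] | a in [set: A]].

(* Main.v *)
Require Import Defs.
From HB Require Import structures.
From mathcomp Require Import all_boot all_order all_algebra all_fingroup.
From mathcomp Require Import finmap.
From mathcomp Require Import all_classical all_reals all_analysis.
From mathcomp Require Import ring lra.

(** The expected number of good maps psi is an explicit ratio of factorials,
whose exponential rate is the functional F.

A uniform homomorphism to Sym(n) is an r-tuple of independent uniform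
permutations p_1, ..., p_r, the images of the generators.  Fix a finite set C
and ask how many pairs (p, Psi), with Psi : {1..n} -> C, have prescribed edge
counts: for each i and each (a, b) in C x C, exactly W_i(a, b) points j with
Psi(j) = a and Psi(p_i j) = b.  When both marginals of every W_i are equal to
k, this number is n! * (prod_c k(c)!)^(2r) divided by
prod_i prod_e W_i(e)! * prod_c k(c)! (card_edge_models).  Dividing by (n!)^r
and taking logarithms with Stirling's bounds gives
n * ((1 - 2r) H(k/n) + sum_i H(W_i/n)) + O(log n) (ln_card_edge_models).  So
the rate is edge_entropy, and this is F(T, alpha^m) when C is the set of names
on the ball B(e, m), k/n the law of the name of x, and W_i/n the joint law of
the names of x and of T_(s_i) x.

Upper bound (Sigma_entropy_le).  Let H contain B(e, m) and its right translates
by the generators.  If psi is close to phi on H, then Psi = psi^(B(e, m)) has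
edge frequencies close to those of phi, and psi is recovered from Psi.  Only
polynomially many edge counts W occur, and the rate is continuous in W, so the
expectation grows at rate at most F(T, alpha^m) + delta.

Lower bound (f_invariant_le).  Given H, take a ball B(e, m) containing it.
Simultaneous Diophantine approximation provides infinitely many n with integer
edge counts W such that W/n is close to the true edge law, the marginals agree
exactly, and W vanishes where the edge law does (integer_circulation).  The
vanishing forces any Psi with edge counts W to be consistent along every edge,
that is, Psi(p_i j)(g) = Psi(j)(g s_i); going through the ball step by step
gives Psi = psi^(B(e, m)) with psi(j) = Psi(j)(e) (edge_models_le).  So each
such Psi comes from a good psi, and the expectation is at least
exp(n (F(T, alpha^m) - delta)) infinitely often, which is enough for a limsup.

Both kinds of G enter through the same few properties (free_system), and the
argument is carried out once from these. *)

Set Implicit Arguments.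
Unset Strict Implicit.
Unset Printing Implicit Defensive.

Import Order.TTheory GRing.Theory Num.Theory.

(** * Counting permutations and colourings *)

Definition fiber_card (I : finType) (C : eqType) (f : I -> C) (c : C) : nat :=
  #|[pred j | f j == c]|.

Lemma fiber_card_sum (I : finType) (C : eqType) (f : I -> C) c :
  fiber_card f c = (\sum_(j | f j == c) 1)%N.
Proof. by rewrite sum1_card. Qed.

Lemma eq_fiber_card (I : finType) (C : eqType) (f g : I -> C) c :
  f =1 g -> fiber_card f c = fiber_card g c.
Proof. by move=> fg; apply: eq_card => j; rewrite !inE fg. Qed.

Lemma fiber_card_comp (I D : finType) (C : eqType) (h : D -> C) (f : I -> D) c :
  fiber_card (h \o f) c = (\sum_(d | h d == c) fiber_card f d)%N.
Proof.
rewrite fiber_card_sum (partition_big f (fun d => h d == c)) //=.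
apply: eq_bigr => d /eqP hd; rewrite fiber_card_sum.
by apply: eq_bigl => j; case: (f j =P d) => [->|]; rewrite ?andbF ?andbT ?hd ?eqxx.
Qed.

Lemma sum_fiber_card (I C : finType) (f : I -> C) :
  (\sum_c fiber_card f c)%N = #|I|.
Proof.
rewrite -sum1_card (partition_big f predT) //=.
by apply: eq_bigr => c _; rewrite fiber_card_sum.
Qed.

Lemma fiber_card_perm (I C : finType) (f : I -> C) (s : {perm I}) c :
  fiber_card (f \o s) c = fiber_card f c.
Proof.
rewrite !fiber_card_sum [RHS](reindex_inj (@perm_inj _ s)).
by apply: eq_bigl.
Qed.

Lemma card_perm_ord0 n (i : 'I_n.+1) (P : pred 'S_n.+1) :
  #|[pred s : 'S_n.+1 | (s ord0 == i) && P s]| =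
  #|[pred s : 'S_n | P (lift_perm ord0 i s)]|.
Proof.
have inj : injective (@lift_perm n ord0 i).
  move=> s t st; apply/permP => k; apply: (@lift_inj _ i).
  by rewrite -(lift_perm_lift ord0 i s) -(lift_perm_lift ord0 i t) st.
rewrite -(card_imset _ inj); apply: eq_card => s; rewrite !inE.
apply/andP/imsetP => [[/eqP s0 Ps]|[t]]; last first.
  by rewrite !inE => Pt ->; rewrite lift_perm_id eqxx.
pose g (k : 'I_n) := odflt k (unlift i (s (lift ord0 k))).
have gE k : lift i (g k) = s (lift ord0 k).
  rewrite /g; case: unliftP => [j ->|] //= sk.
  by have /eqP := neq_lift ord0 k; rewrite -s0 in sk; move/perm_inj: sk => ->.
have ginj : injective g.
  by move=> a b /(congr1 (lift i)); rewrite !gE => /perm_inj/lift_inj.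
have sE : s = lift_perm ord0 i (perm ginj).
  apply/permP => k; case: (unliftP ord0 k) => [k'|] ->; last by rewrite lift_perm_id.
  by rewrite lift_perm_lift permE gE.
by exists (perm ginj); rewrite // inE -sE.
Qed.

Lemma fiber_card_lift n (C : eqType) (f : 'I_n.+1 -> C) i c :
  fiber_card f c = ((f i == c) + fiber_card (f \o lift i) c)%N.
Proof.
rewrite !fiber_card_sum !(big_mkcond (fun j => _ == c)) /=.
by rewrite (bigD1_ord i) //=; case: (f i == c).
Qed.

(** Such an s is a choice of a bijection from each fibre of g to the fibre of f
over the same colour.  The induction removes the point 0: its image ranges over
one fibre of f, and the rest is a permutation of the other points. *)
Lemma card_perm_intertwine n (C : finType) (f g : 'I_n -> C) :
  (forall c, fiber_card f c = fiber_card g c) ->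
  #|[pred s : 'S_n | [forall j, f (s j) == g j]]| = (\prod_c (fiber_card f c)`!)%N.
Proof.
elim: n f g => [|n IHn] f g fg.
  rewrite (eq_card (_ : _ =i predT)) ?card_Sn ?big1 //.
    by move=> c _; rewrite /fiber_card (eq_card0 (_ : _ =i pred0)) // => -[].
  by move=> s; rewrite !inE; apply/forallP => -[].
rewrite -sum1_card.
rewrite (partition_big (fun s : 'S_n.+1 => s ord0) (fun i => f i == g ord0)) /=;
  last first.
  by move=> s /forallP/(_ ord0).
set c0 := g ord0.
have step i : f i == c0 ->
  (\sum_(s : 'S_n.+1 | [pred s : 'S__ | [forall j, f (s j) == g j]] s
                         && (s ord0 == i)) 1)%N
    = ((fiber_card f c0).-1`! * \prod_(c | c != c0) (fiber_card f c)`!)%N.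
  move=> /eqP fi.
  have -> : ((fiber_card f c0).-1`! * \prod_(c | c != c0) (fiber_card f c)`!)%N =
            (\prod_c (fiber_card (f \o lift i) c)`!)%N.
    rewrite [RHS](bigD1 c0) //=; congr (factorial _ * _)%N.
      by rewrite (fiber_card_lift f i) fi eqxx.
    apply: eq_bigr => c cc0; rewrite (fiber_card_lift f i) fi.
    by rewrite eq_sym (negbTE cc0).
  rewrite -(IHn _ (g \o lift ord0)); last first.
    move=> c; have := fg c; rewrite (fiber_card_lift f i) (fiber_card_lift g ord0).
    by rewrite fi => /eqP; rewrite eqn_add2l => /eqP.
  rewrite sum1_card.
  rewrite -(eq_card (_ : [pred s : 'S_n.+1 | (s ord0 == i) &&
                            [forall j, f (s j) == g j]] =i _)); last first.
    by move=> s; rewrite !inE andbC.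
  rewrite card_perm_ord0; apply: eq_card => s; rewrite !inE.
  apply/forallP/forallP => H j.
    by have := H (lift ord0 j); rewrite lift_perm_lift.
  by case: (unliftP ord0 j) => [k|] ->; rewrite ?lift_perm_lift ?lift_perm_id ?H ?fi /=.
rewrite (eq_bigr _ step) sum_nat_const [RHS](bigD1 c0) //= mulnA; congr muln.
have -> : #|(fun i => f i == c0)| = fiber_card f c0 by [].
have : (0 < fiber_card f c0)%N by rewrite fg (fiber_card_lift _ ord0) eqxx.
by case: (fiber_card f c0) => // m _; rewrite factS.
Qed.

Lemma exists_coloring (C : finType) (k : C -> nat) n : (\sum_c k c)%N = n ->
  exists f : {ffun 'I_n -> C}, forall c, fiber_card f c = k c.
Proof.
move=> kn; pose s := flatten [seq nseq (k c) c | c <- enum C].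
have sz : size s = n.
  rewrite size_flatten /shape -map_comp sumnE big_map big_enum /= -kn.
  by apply: eq_bigr => c _; rewrite size_nseq.
have szE := introT eqP sz; pose t : n.-tuple C := Tuple szE.
exists [ffun j => tnth t j] => c.
transitivity (count_mem c s).
  rewrite -[s]/(tval t) -sum1_count big_tuple fiber_card_sum.
  by apply: eq_bigl => j; rewrite ffunE.
rewrite count_flatten -map_comp sumnE big_map big_enum /= (bigD1 c) //= big1 ?addn0.
  by rewrite count_nseq /= eqxx mul1n.
by move=> d dc; rewrite count_nseq /= (negbTE dc).
Qed.

(** The permutations preserving f act on these t by composition, transitively,
and the stabilizer of one of them is the group of permutations that preserve t;
both groups are counted by card_perm_intertwine.  Taking D = C x C and h the
first projection counts edge labellings over f, and C a point counts colourings
with given colour frequencies. *)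
Lemma card_coloring_over n (D C : finType) (h : D -> C) (f : 'I_n -> C) (w : D -> nat) :
  (forall c, \sum_(d | h d == c) w d = fiber_card f c)%N ->
  (#|[pred t : {ffun 'I_n -> D} | [forall j, h (t j) == f j] &&
        [forall d, fiber_card t d == w d]]| * \prod_d (w d)`! =
   \prod_c (fiber_card f c)`!)%N.
Proof.
move=> wf.
have sw : (\sum_d w d)%N = n.
  rewrite (partition_big h predT) //= -[RHS](card_ord n) -(sum_fiber_card f).
  by apply: eq_bigr => c _; rewrite wf.
have [t1 t1w] := exists_coloring sw.
have [s1 s1P] : exists s : 'S_n, forall j, h (t1 (s j)) = f j.
  have /card_perm_intertwine : forall c, fiber_card (h \o t1) c = fiber_card f c.
    by move=> c; rewrite fiber_card_comp -wf; apply: eq_bigr => d _.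
  (* A number of permutations that is a product of factorials is not 0. *)
  have : (0 < \prod_c (fiber_card (h \o t1) c)`!)%N.
    by rewrite prodn_gt0 // => c; rewrite fact_gt0.
  move=> pos e; move: pos; rewrite -e => /card_gt0P[s]; rewrite inE => /forallP sP.
  by exists s => j; apply/eqP/sP.
pose t0 j := t1 (s1 j).
have t0w d : fiber_card t0 d = w d by rewrite (fiber_card_perm t1 s1).
rewrite -(card_perm_intertwine (g := f)) // -[RHS]sum1_card.
rewrite (partition_big (fun s : 'S_n => [ffun j => t0 (s j)])
   [pred t : {ffun 'I_n -> D} | [forall j, h (t j) == f j] &&
        [forall d, fiber_card t d == w d]]) /=; last first.
  move=> s; rewrite !inE => /forallP sf; apply/andP; split; apply/forallP => j.
    by rewrite ffunE /t0 s1P sf.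
  rewrite -t0w -(fiber_card_perm t0 s); apply/eqP/eq_fiber_card => i.
  by rewrite ffunE.
rewrite -sum_nat_const; apply: eq_bigr => t.
rewrite inE => /andP[/forallP tf /forallP tw].
transitivity (\prod_d (fiber_card t0 d)`!)%N; first by apply: eq_bigr => d _; rewrite t0w.
rewrite -(card_perm_intertwine (g := t)); last first.
  by move=> d; rewrite t0w; apply/esym/eqP/tw.
rewrite sum1_card; apply: eq_card => s; rewrite !inE.
apply/forallP/andP => [H|[_ /eqP <-] j]; last by rewrite ffunE.
split; last by apply/eqP/ffunP => j; rewrite ffunE; apply/eqP.
by apply/forallP => j; rewrite -(eqP (tf j)) -(eqP (H j)) /t0 s1P.
Qed.

Definition edge_label n (C : Type) (f : 'I_n -> C) (s : 'S_n) (j : 'I_n) : C * C :=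
  (f j, f (s j)).

(** A permutation is chosen in two stages: first the edge labelling j |->
(f j, f (s j)), which lies over f and has frequencies w, and then s itself,
which must send j to a point with colour the second label of j.  The first
stage has prod k! / prod w! outcomes, the second prod k!. *)
Lemma card_perm_edge n (C : finType) (f : 'I_n -> C) (w : C * C -> nat) :
  (forall c, \sum_(e : C * C | e.1 == c) w e = fiber_card f c)%N ->
  (forall c, \sum_(e : C * C | e.2 == c) w e = fiber_card f c)%N ->
  (#|[pred s : 'S_n | [forall e, fiber_card (edge_label f s) e == w e]]|
     * \prod_e (w e)`! = (\prod_c (fiber_card f c)`!) ^ 2)%N.
Proof.
move=> w1 w2; rewrite expnS expn1 -{1}(card_coloring_over w1) mulnAC; congr muln.
rewrite -sum1_card (partition_big (fun s : 'S_n => [ffun j => edge_label f s j])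
   [pred t : {ffun 'I_n -> C * C} | [forall j, (t j).1 == f j] &&
        [forall d, fiber_card t d == w d]]) /=; last first.
  move=> s; rewrite !inE => /forallP sf; apply/andP; split; apply/forallP => j.
    by rewrite ffunE.
  by rewrite -(eqP (sf j)); apply/eqP/eq_fiber_card => i; rewrite ffunE.
rewrite -sum_nat_const; apply: eq_bigr => t => /andP[/forallP tf /forallP tw].
rewrite -(card_perm_intertwine (g := fun j => (t j).2)); last first.
  move=> c; rewrite -w2 (fiber_card_comp snd t).
  by apply: eq_bigr => d _; apply/esym/eqP/tw.
rewrite sum1_card; apply: eq_card => s; rewrite !inE.
apply/andP/forallP => [[_ /eqP <-] j|H]; first by rewrite ffunE.
have e : [ffun j => edge_label f s j] = t.
  apply/ffunP => j; rewrite ffunE /edge_label (eqP (H j)) -(eqP (tf j)).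
  by case: (t j).
split; last exact/eqP.
apply/forallP => d; rewrite -(eqP (tw d)); apply/eqP/eq_fiber_card => i.
by rewrite -e ffunE.
Qed.

Lemma edge_label_src n (C : finType) (f : 'I_n -> C) s c :
  (\sum_(e : C * C | e.1 == c) fiber_card (edge_label f s) e = fiber_card f c)%N.
Proof. by rewrite -fiber_card_comp. Qed.

Lemma edge_label_tgt n (C : finType) (f : 'I_n -> C) s c :
  (\sum_(e : C * C | e.2 == c) fiber_card (edge_label f s) e = fiber_card f c)%N.
Proof. by rewrite -fiber_card_comp -(fiber_card_perm f s). Qed.

Definition edge_models (r n : nat) (C : finType) (W : 'I_r -> C * C -> nat) :=
  [pred x : {ffun 'I_r -> 'S_n} * {ffun 'I_n -> C} |
     [forall i, [forall e, fiber_card (edge_label x.2 (x.1 i)) e == W i e]]].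

(** Given Psi, the r permutations are independent, and the number of choices for
each depends only on the colour frequencies k of Psi; these are the same for
all Psi that occur, since they are a marginal of W. *)
Lemma card_edge_models (r n : nat) (C : finType) (W : 'I_r -> C * C -> nat)
    (k : C -> nat) : (0 < r)%N -> (\sum_c k c)%N = n ->
  (forall i c, \sum_(e : C * C | e.1 == c) W i e = k c)%N ->
  (forall i c, \sum_(e : C * C | e.2 == c) W i e = k c)%N ->
  (#|edge_models n W| * (\prod_i \prod_e (W i e)`!) * \prod_c (k c)`! =
   n`! * (\prod_c (k c)`!) ^ (2 * r))%N.
Proof.
move=> r0 kn W1 W2.
pose K := (\prod_c (k c)`!)%N.
pose Q := [pred f : {ffun 'I_n -> C} | [forall c, fiber_card f c == k c]].
have QK : (#|Q| * K = n`!)%N.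
  have := @card_coloring_over n C unit (fun=> tt) (fun=> tt) k.
  have fu c : fiber_card (fun _ : 'I_n => tt) c = n.
    by case: c; rewrite fiber_card_sum sum1_card card_ord.
  rewrite (big_pred1 tt) ?fu; last by case.
  move=> <-; last by case; rewrite fu -kn; apply: eq_bigl.
  congr (_ * _)%N; apply: eq_card => t; rewrite !inE.
  by apply/esym/andb_idl => _; apply/forallP.
have EM : (#|edge_models n W| * (\prod_i \prod_e (W i e)`!) = #|Q| * (K ^ (2 * r)))%N.
  rewrite -sum1_card big_mkcond /=.
  rewrite (eq_bigr (fun x : {ffun 'I_r -> 'S_n} * {ffun 'I_n -> C} => \prod_i
     ([forall e, fiber_card (edge_label x.2 (x.1 i)) e == W i e] : nat))%N); last first.
    move=> x _; rewrite inE; case: forallP => [H|H].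
      by rewrite big1 // => i _; rewrite H.
    case: (pickP (fun i => ~~ [forall e, fiber_card (edge_label x.2 (x.1 i)) e == W i e])).
      by move=> i /negbTE iN; rewrite (bigD1 i) //= iN.
    by move=> H'; case: H => i; have := H' i; case: forallP.
  rewrite -(pair_bigA _ (fun (p : {ffun 'I_r -> 'S_n}) (f : {ffun 'I_n -> C}) => (\prod_i
     ([forall e, fiber_card (edge_label f (p i)) e == W i e] : nat))%N)) /=.
  rewrite exchange_big /= big_distrl /= (bigID Q) /= [X in (_ + X)%N]big1 ?addn0.
    rewrite -sum_nat_const; apply: eq_bigr => f /forallP fk.
    rewrite -(bigA_distr_bigA (fun i (s : 'S_n) => nat_of_bool
       [forall e, fiber_card (edge_label f s) e == W i e])) -big_split /=.
    rewrite expnM (eq_bigr (fun=> K ^ 2)%N) ?prod_nat_const ?card_ord // => i _.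
    rewrite -(_ : (\prod_c (fiber_card f c)`!)%N = K); last first.
      by apply: eq_bigr => c _; rewrite (eqP (fk c)).
    rewrite -(card_perm_edge (w := W i)); last 2 first.
    - by move=> c; rewrite W1 (eqP (fk c)).
    - by move=> c; rewrite W2 (eqP (fk c)).
    congr muln; rewrite -sum1_card [RHS]big_mkcond /=; apply: eq_bigr => s _.
    by rewrite inE; case: forallP.
  move=> f; rewrite negb_forall => /existsP[c fc].
  rewrite big1 ?mul0n // => p _; rewrite (bigD1 (Ordinal r0)) //=.
  case: forallP => //= H; case/negP: fc.
  rewrite -(W1 (Ordinal r0)) -(edge_label_src f (p (Ordinal r0))).
  by apply/eqP/eq_bigr => e _; apply/eqP.
by rewrite EM mulnAC QK.
Qed.

Local Open Scope ring_scope.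

(** * Entropy function and Stirling bounds *)

(** A crude bound that serves twice: for the modulus of continuity of x ln x at
0, and to make the logarithmic error terms negligible against n. *)
Lemma ln_le_2sqrt (R : realType) (x : R) : 0 < x -> ln x <= 2 * Num.sqrt x.
Proof.
move=> x0; have s0 : 0 < Num.sqrt x by rewrite sqrtr_gt0.
have := ln_sublinear s0.
have -> : ln x = ln (Num.sqrt x) *+ 2 by rewrite -lnXn // sqr_sqrtr // ltW.
lra.
Qed.

Definition eta (R : realType) (x : R) : R := - (x * ln x).

Lemma eta0 (R : realType) : eta (0 : R) = 0.
Proof. by rewrite /eta mul0r oppr0. Qed.

Lemma eta_ge0 (R : realType) (x : R) : 0 <= x <= 1 -> 0 <= eta x.
Proof.
by move=> /andP[x0 x1]; rewrite /eta -mulrN mulr_ge0 // oppr_ge0 ln_le0.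
Qed.

Lemma eta_le_2sqrt (R : realType) (x : R) : 0 <= x -> eta x <= 2 * Num.sqrt x.
Proof.
rewrite le_eqVlt => /predU1P[<-|x0].
  by rewrite /eta mul0r oppr0 mulr_ge0 ?sqrtr_ge0.
have := @ln_le_2sqrt R x^-1; rewrite invr_gt0 x0 => /(_ isT).
rewrite lnV ?posrE // sqrtrV; last exact: ltW.
set s := Num.sqrt x.
have s0 : 0 < s by rewrite sqrtr_gt0.
have xE : x = s * s by rewrite -expr2 sqr_sqrtr // ltW.
move=> H; rewrite /eta -mulrN {1}xE.
apply: le_trans (_ : s * s * (2 * s^-1) <= _).
  by rewrite ler_pM2l // mulr_gt0.
by rewrite le_eqVlt; apply/orP; left; apply/eqP; field; rewrite gt_eqF.
Qed.

(** For x > 0 and t = y - x, eta x - eta y is the difference of x (ln y - ln x),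
which is between 0 and t, and - t ln y, which is between 0 and eta t since
t <= y <= 1. *)
Lemma eta_modulus_le (R : realType) (x y : R) : 0 <= x -> x <= y -> y <= 1 ->
  `|eta x - eta y| <= 3 * Num.sqrt (y - x).
Proof.
move=> x0 xy y1; set t := y - x.
have t0 : 0 <= t by rewrite subr_ge0.
have t1 : t <= 1 by rewrite /t; lra.
have s0 : 0 <= Num.sqrt t := sqrtr_ge0 t.
have s1 : Num.sqrt t <= 1 by rewrite -[leRHS]sqrtr1 ler_sqrt.
have st : t <= Num.sqrt t by have := sqr_sqrtr t0; rewrite expr2; nra.
have := eta_le_2sqrt t0.
move: x0; rewrite le_eqVlt => /predU1P[x0|x0].
  rewrite /t -x0 subr0 eta0 sub0r normrN => H.
  have y0 : 0 <= y by rewrite x0.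
  rewrite ger0_norm ?eta_ge0 ?y0 //.
  by apply: le_trans H _; rewrite ler_wpM2r ?sqrtr_ge0 // ler_nat.
have y0 : 0 < y := lt_le_trans x0 xy.
move: t0; rewrite le_eqVlt => /predU1P[t0|t0].
  have -> : y = x by apply/eqP; rewrite -subr_eq0 -/t -t0.
  by rewrite subrr normr0 mulr_ge0 ?sqrtr_ge0.
have lyx : 0 <= ln y - ln x <= t / x.
  have -> : ln y - ln x = ln (1 + t / x).
    rewrite -ln_div ?posrE //; congr ln; rewrite /t; field; lra.
  have tx : 0 <= t / x by rewrite divr_ge0 // ltW.
  rewrite ln_ge0 ?lerDl //= le_ln1Dx //; lra.
have xl : x * (ln y - ln x) <= t.
  have /andP[_] := lyx; rewrite -(ler_pM2l x0) => /le_trans; apply.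
  by rewrite mulrCA divff ?mulr1 // gt_eqF.
have ty : 0 <= - (t * ln y) <= eta t.
  rewrite /eta lerN2 ler_pM2l // ler_ln ?posrE //; have := ln_le0 y1.
  rewrite /t; nra.
have -> : eta x - eta y = x * (ln y - ln x) - (- (t * ln y)).
  by rewrite /eta /t; ring.
case/andP: ty => ty0 ty1; case/andP: lyx => ly0 _.
have xl0 : 0 <= x * (ln y - ln x) by rewrite mulr_ge0 // ltW.
move=> H; rewrite ler_norml; apply/andP; split; [lra|nra].
Qed.

Lemma eta_modulus (R : realType) (x y e : R) : 0 <= x <= 1 -> 0 <= y <= 1 ->
  `|x - y| <= e -> `|eta x - eta y| <= 3 * Num.sqrt e.
Proof.
move=> /andP[x0 x1] /andP[y0 y1] xye.
apply: le_trans (_ : 3 * Num.sqrt `|x - y| <= _); last first.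
  by rewrite ler_pM2l // ler_wsqrtr.
case: (leP x y) => xy.
  by rewrite (distrC x y) (@ger0_norm _ (y - x)) ?subr_ge0 // eta_modulus_le.
have yx := ltW xy.
by rewrite (@ger0_norm _ (x - y)) ?subr_ge0 // distrC eta_modulus_le.
Qed.

Definition lnfact (R : realType) (n : nat) : R := ln (n`!%:R).

(** The error D(n) satisfies D(n+1) - D(n) = 1 - n ln (1 + 1/n).  This is
nonnegative, and at most 1/(n+1), hence at most ln (n+1) - ln n.  The value
ln 0 = 0 makes the statement true at n = 0. *)
Lemma stirling_bounds (R : realType) (n : nat) :
  0 <= lnfact R n - (n%:R * ln n%:R - n%:R) <= 1 + ln (n%:R : R).
Proof.
case: n => [|n].
  by rewrite /lnfact fact0 ln1 ln0 // mul0r !subr0 ?addr0 lexx ler01.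
elim: n => [|n /andP[IH1 IH2]].
  by rewrite /lnfact factS fact0 muln1 ln1 mulr0 !sub0r opprK addr0 ler01 lexx.
have n0 : 0 < n.+1%:R :> R by rewrite ltr0n.
have -> : lnfact R n.+2 = ln (n.+2%:R : R) + lnfact R n.+1.
  by rewrite /lnfact factS natrM lnM // posrE ltr0n ?fact_gt0.
have nS : n.+2%:R = n.+1%:R + 1 :> R by rewrite natr1.
have lnS : ln (n.+2%:R : R) = ln n.+1%:R + ln (1 + n.+1%:R^-1).
  rewrite -lnM ?posrE ?addr_gt0 ?invr_gt0 //; congr ln.
  by rewrite nS mulrDr mulr1 divff // gt_eqF.
set l := ln (1 + n.+1%:R^-1) in lnS *.
have l1 : n.+1%:R * l <= 1.
  rewrite -ler_pdivlMl // mulr1 le_ln1Dx //.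
  by apply: lt_trans (_ : 0 < _); rewrite ?ltrN10 ?invr_gt0.
have l2 : 1 <= n.+2%:R * l.
  rewrite -ler_pdivrMl ?ltr0n // mulr1.
  have -> : l = - ln (1 - n.+2%:R^-1).
    rewrite -lnV; last by rewrite posrE subr_gt0 invf_lt1 ?ltr1n // ltr0n.
    rewrite /l; congr ln; rewrite nS; field.
    by apply/andP; split; lra.
  rewrite lerNr; apply: le_ln1Dx.
  by rewrite ltrN2 invf_lt1 ?ltr1n // ltr0n.
move: IH1 IH2 l2; rewrite lnS nS; set L := lnfact R n.+1; set a : R := n.+1%:R in n0 l1 *.
set b := ln a => IH1 IH2 l2.
apply/andP; split; nra.
Qed.

(** * Integer circulations near a real one *)

(** Dirichlet's pigeonhole argument, applied to the multiples of N+1 so that the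
denominator found is larger than N: two multiples t1 < t2 have all their
fractional parts in the same boxes of side 1/(Q+1), and their difference works. *)
Lemma simultaneous_dirichlet (R : realType) (J : finType) (x : J -> R)
    (eps : R) (N : nat) : (forall j, 0 <= x j) -> 0 < eps ->
  exists n : nat, exists w : J -> nat,
    (N < n)%N /\ forall j, `|n%:R * x j - (w j)%:R| < eps.
Proof.
move=> x0 e0.
pose Q := Num.bound eps^-1.
have Qe : Q.+1%:R^-1 < eps.
  rewrite invf_plt ?posrE //; apply: lt_trans (archi_boundP _) _.
    by rewrite invr_ge0 ltW.
  by rewrite ltr_nat.
pose u (t : nat) j : R := (N.+1 * t)%:R * x j.
have u0 t j : 0 <= u t j by rewrite mulr_ge0.
pose fr (t : nat) j : R := u t j - (Num.truncn (u t j))%:R.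
have fr01 t j : 0 <= fr t j < 1.
  have /andP[h1 h2] := truncn_itv (u0 t j).
  by rewrite subr_ge0 h1 /= ltrBlDr addrC natr1.
pose box (t : nat) j : nat := Num.truncn (Q.+1%:R * fr t j).
have boxP t j : (box t j)%:R <= Q.+1%:R * fr t j < (box t j)%:R + 1.
  by rewrite natr1 truncn_itv // mulr_ge0 //; case/andP: (fr01 t j).
have boxQ t j : (box t j < Q.+1)%N.
  rewrite -(ltr_nat R); apply: le_lt_trans (_ : Q.+1%:R * fr t j < _).
    by case/andP: (boxP t j).
  by rewrite gtr_pMr ?ltr0n //; case/andP: (fr01 t j).
pose M := #|{ffun J -> 'I_Q.+1}|.
pose h (t : 'I_M.+1) : {ffun J -> 'I_Q.+1} := [ffun j => Ordinal (boxQ t j)].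
have /injectivePn[t1' [t2' t12' h12']] : ~~ injectiveb h.
  apply/negP => /injectiveP/leq_card; rewrite card_ord.
  by rewrite ltnn.
have [t1 [t2 [t12 h12]]] : exists t1 t2 : nat,
    (t1 < t2)%N /\ forall j, box t1 j = box t2 j.
  have hb j : box t1' j = box t2' j.
    by have /ffunP/(_ j) := h12'; rewrite !ffunE => /(congr1 val).
  case: (ltngtP t1' t2') => [lt|lt|eq].
  - by exists t1', t2'.
  - by exists t2', t1'; split.
  - by move/val_inj: eq t12' => ->; rewrite eqxx.
exists (N.+1 * (t2 - t1))%N,
  (fun j => Num.truncn (u t2 j) - Num.truncn (u t1 j))%N; split.
  by rewrite leq_pmulr // subn_gt0.
move=> j.
have mono : (Num.truncn (u t1 j) <= Num.truncn (u t2 j))%N.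
  by apply: le_truncn; rewrite /u ler_wpM2r // ler_nat leq_mul // ltnW.
rewrite mulnBr natrB ?leq_mul // 1?ltnW // natrB // mulrBl.
have -> : (N.+1 * t2)%:R * x j - (N.+1 * t1)%:R * x j -
  ((Num.truncn (u t2 j))%:R - (Num.truncn (u t1 j))%:R) = fr t2 j - fr t1 j.
  by rewrite /fr /u; ring.
apply: lt_trans Qe; rewrite -(ltr_pM2l (_ : 0 < Q.+1%:R)) ?ltr0n //.
rewrite divff ?gt_eqF ?ltr0n // -[Q.+1%:R in X in X < _]gtr0_norm ?ltr0n //.
rewrite -normrM mulrBr.
have /andP[a1 a2] := boxP t1 j; have /andP[b1 b2] := boxP t2 j.
rewrite -h12 in b1 b2.
rewrite ltr_norml; apply/andP; split; lra.
Qed.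

(** This turns approximate linear relations between integers into exact ones. *)
Lemma nat_eq_of_close (R : realType) (a b : nat) :
  `|a%:R - b%:R : R| < 1 -> a = b.
Proof.
wlog ab : a b / (a <= b)%N => [hw|].
  by case/orP: (leq_total a b) => h; [exact: hw|rewrite distrC => /(hw _ _ h)].
rewrite distrC -natrB // normr_nat ltrn1 ltnS leqn0 subn_eq0 => ba.
by apply/eqP; rewrite eqn_leq ab.
Qed.

Lemma ler_norm_sum_const (R : realType) (J : finType) (Q : pred J) (F : J -> R) e :
  0 <= e -> (forall j, Q j -> `|F j| <= e) -> `|\sum_(j | Q j) F j| <= #|J|%:R * e.
Proof.
move=> e0 H; apply: le_trans (ler_norm_sum _ _ _) _.
apply: le_trans (ler_sum _ H) _.
rewrite sumr_const -[leLHS]mulr_natl ler_wpM2r // ler_nat; exact: max_card.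
Qed.

(** If n p(c) and n P_i(e) are all within d of the integers k(c) and W_i(e), then
each of the linear relations with integer coefficients satisfied by p and P
holds for k and W up to (number of terms + 1) * d < 1, hence exactly.  In the
same way, a coordinate equal to 0 is approximated by exactly 0. *)
Lemma integer_circulation (R : realType) (r : nat) (C : finType)
    (p : C -> R) (P : 'I_r -> C * C -> R) (eps : R) (N : nat) :
  0 < eps -> (forall c, 0 <= p c) -> (forall i e, 0 <= P i e) -> \sum_c p c = 1 ->
  (forall i c, \sum_(e : C * C | e.1 == c) P i e = p c) ->
  (forall i c, \sum_(e : C * C | e.2 == c) P i e = p c) ->
  exists n : nat, exists W : 'I_r -> C * C -> nat, exists k : C -> nat,
  [/\ (N < n)%N, (\sum_c k c)%N = n,
      forall i c, (\sum_(e : C * C | e.1 == c) W i e)%N = k c,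
      forall i c, (\sum_(e : C * C | e.2 == c) W i e)%N = k c &
      [/\ forall i e, P i e = 0 -> W i e = 0%N,
          forall i e, `|(W i e)%:R / n%:R - P i e| <= eps &
          forall c, `|(k c)%:R / n%:R - p c| <= eps]].
Proof.
move=> e0 p0 P0 p1 P1 P2.
pose J : finType := (C + 'I_r * (C * C))%type.
pose x (j : J) := match j with inl c => p c | inr (i, e) => P i e end.
have x0 j : 0 <= x j by case: j => [c|[i e]] /=.
pose K : R := #|J|%:R + 1.
have K0 : 0 < K by rewrite ltr_wpDl.
(* A relation involves at most #|J| + 1 = K terms, so its error is below 1. *)
pose d := Num.min (eps / 2) (K^-1 / 2).
have d0 : 0 < d by rewrite lt_min !divr_gt0 ?invr_gt0.
have [n [w [Nn wn]]] := simultaneous_dirichlet N x0 d0.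
have n0 : 0 < n%:R :> R by rewrite ltr0n (leq_ltn_trans _ Nn).
have n1 : 1 <= n%:R :> R by rewrite ler1n (leq_ltn_trans _ Nn).
have dK : d * K <= 2^-1.
  apply: le_trans (_ : K^-1 / 2 * K <= _).
    by apply: ler_wpM2r; [exact: ltW|rewrite /d ge_min lexx orbT].
  by rewrite mulrAC mulVf ?gt_eqF // mul1r.
have dC (I : finType) : (#|I| <= #|J|)%N -> #|I|%:R * d + d <= 2^-1.
  move=> IJ; apply: le_trans dK; rewrite -[X in _ + X]mul1r -mulrDl mulrC.
  by rewrite ler_pM2l // lerD2r ler_nat.
have deps : d < eps.
  apply: le_lt_trans (_ : eps / 2 < _); first by rewrite /d ge_min lexx.
  by rewrite ltr_pdivrMr // ltr_pMr // ltr1n.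
have close j : `|(w j)%:R / n%:R - x j| <= eps.
  have -> : (w j)%:R / n%:R - x j = ((w j)%:R - n%:R * x j) / n%:R.
    by rewrite mulrBl mulrAC divff ?mul1r // gt_eqF.
  rewrite normrM normfV (@gtr0_norm _ n%:R) // ler_pdivrMr // distrC.
  apply: le_trans (ltW (wn j)) _; apply: le_trans (ltW deps) _.
  by rewrite ler_peMr // ltW.
have marg (i : 'I_r) c (Q : pred (C * C)) : \sum_(e | Q e) P i e = p c ->
    (\sum_(e | Q e) w (inr (i, e)))%N = w (inl c).
  move=> HQ; apply: (@nat_eq_of_close R).
  have -> : ((\sum_(e | Q e) w (inr (i, e)))%N)%:R - (w (inl c))%:R =
     (n%:R * p c - (w (inl c))%:R) - \sum_(e | Q e) (n%:R * P i e - (w (inr (i, e)))%:R).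
    by rewrite sumrB -mulr_sumr HQ -natr_sum; ring.
  apply: le_lt_trans (ler_normB _ _) _.
  have IJ : (#|{: C * C}| <= #|{: J}|)%N.
    rewrite card_sum !card_prod card_ord; apply: leq_trans (leq_addl _ _).
    by rewrite leq_pmull // (leq_ltn_trans _ (ltn_ord i)).
  have := dC _ IJ; have := wn (inl c).
  have := @ler_norm_sum_const R _ Q
    (fun e => n%:R * P i e - (w (inr (i, e)))%:R) d (ltW d0).
  move=> /(_ (fun e _ => ltW (wn (inr (i, e))))) /=; lra.
have IJ : (#|C| <= #|{: J}|)%N by rewrite card_sum leq_addr.
exists n, (fun i e => w (inr (i, e))), (fun c => w (inl c)); split => //.
- apply: (@nat_eq_of_close R).
  have -> : ((\sum_c w (inl c))%N)%:R - n%:R = - \sum_c (n%:R * p c - (w (inl c))%:R).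
    by rewrite sumrB -mulr_sumr p1 -natr_sum; ring.
  rewrite normrN.
  have := @ler_norm_sum_const R _ predT (fun c => n%:R * p c - (w (inl c))%:R) d (ltW d0).
  move=> /(_ (fun c _ => ltW (wn (inl c)))) /=; have := dC _ IJ; lra.
- by move=> i c; apply: marg.
- by move=> i c; apply: marg.
- split => [i e Pie|i e|c]; [|exact: close|exact: close].
  apply: (@nat_eq_of_close R); rewrite distrC.
  have := wn (inr (i, e)); rewrite /= Pie mulr0 => /lt_trans; apply.
  have Jd : 0 <= #|J|%:R * d by apply: mulr_ge0 => //; exact: ltW.
  have := dC J (leqnn _); lra.
Qed.

(** * Growth rate of the number of edge models *)

(** The functional F of an observable with law p whose joint law with its
translate by the i-th generator is P i. *)
Definition edge_entropy (R : realType) (r : nat) (C : finType)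
    (p : C -> R) (P : 'I_r -> C * C -> R) : R :=
  (1 - 2 * r%:R) * (\sum_c eta (p c)) + \sum_i \sum_e eta (P i e).

(** The estimate is uniform, so that a single eps serves for all n. *)
Lemma edge_entropy_modulus (R : realType) (r : nat) (C : finType)
    (p q : C -> R) (P Q : 'I_r -> C * C -> R) (e : R) : (0 < r)%N ->
  (forall c, 0 <= p c <= 1) -> (forall c, 0 <= q c <= 1) ->
  (forall i e, 0 <= P i e <= 1) -> (forall i e, 0 <= Q i e <= 1) ->
  (forall c, `|p c - q c| <= e) -> (forall i x, `|P i x - Q i x| <= e) ->
  `|edge_entropy p P - edge_entropy q Q| <=
     (2 * r%:R * #|C|%:R + r%:R * #|{: C * C}|%:R) * (3 * Num.sqrt e).
Proof.
move=> r0 p1 q1 P1 Q1 pq PQ; set t := 3 * Num.sqrt e.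
have t0 : 0 <= t by rewrite mulr_ge0 // sqrtr_ge0.
have r1 : 1 <= r%:R :> R by rewrite ler1n.
have H1 : `|\sum_c (eta (p c) - eta (q c))| <= #|C|%:R * t.
  by apply: ler_norm_sum_const => // c _; apply: eta_modulus.
have H2 : `|\sum_i \sum_x (eta (P i x) - eta (Q i x))| <= r%:R * (#|{: C * C}|%:R * t).
  rewrite -[r in X in _ <= X]card_ord; apply: ler_norm_sum_const => [|i _].
    by rewrite mulr_ge0.
  by apply: ler_norm_sum_const => // x _; apply: eta_modulus.
have -> : edge_entropy p P - edge_entropy q Q =
   (1 - 2 * r%:R) * (\sum_c (eta (p c) - eta (q c)))
   + \sum_i \sum_x (eta (P i x) - eta (Q i x)).
  rewrite /edge_entropy sumrB.
  have -> : \sum_i \sum_x (eta (P i x) - eta (Q i x)) =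
      \sum_i (\sum_x eta (P i x) - \sum_x eta (Q i x)).
    by apply: eq_bigr => i _; rewrite sumrB.
  by rewrite sumrB; ring.
apply: le_trans (ler_normD _ _) _; rewrite normrM ler0_norm ?subr_le0; last lra.
set c := #|C|%:R in H1 *; set S1 := `|_| in H1 *.
have c0 : 0 <= c * t by rewrite mulr_ge0.
have : (2 * r%:R - 1) * S1 <= 2 * r%:R * (c * t).
  apply: le_trans (_ : (2 * r%:R - 1) * (c * t) <= _); last first.
    by rewrite ler_wpM2r // lerBlDr lerDl.
  by rewrite ler_wpM2l // subr_ge0; lra.
lra.
Qed.

Lemma ln_prodn (R : realType) (J : finType) (F : J -> nat) :
  (forall j, 0 < F j)%N ->
  ln ((\prod_j F j)%N%:R : R) = \sum_j ln ((F j)%:R : R).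
Proof.
move=> F0; have [] : (0 < (\prod_j F j)%N)%N /\
  ln ((\prod_j F j)%N%:R : R) = \sum_j ln ((F j)%:R : R); last by [].
apply: (big_rec2 (fun a (b : R) => (0 < a)%N /\ ln (a%:R : R) = b)).
  by rewrite ln1.
move=> j a b _ [a0 <-]; rewrite muln_gt0 F0 a0; split => //.
by rewrite natrM lnM // posrE ltr0n.
Qed.

(** Writing ln m! = m ln m - m + D(m) with 0 <= D(m) <= 1 + ln n, the linear terms
cancel in the exact count because 1 - r + (2r - 1) - r = 0, and so do the terms
in ln n that come from m ln m = m ln n - n eta (m / n). *)
Lemma ln_card_edge_models (R : realType) (r n : nat) (C : finType)
    (W : 'I_r -> C * C -> nat) (k : C -> nat) :
  (0 < r)%N -> (0 < n)%N -> (\sum_c k c)%N = n ->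
  (forall i c, \sum_(e : C * C | e.1 == c) W i e = k c)%N ->
  (forall i c, \sum_(e : C * C | e.2 == c) W i e = k c)%N ->
  0 < #|edge_models n W|%:R / n`!%:R ^+ r :> R /\
  `|ln (#|edge_models n W|%:R / n`!%:R ^+ r : R)
     - n%:R * edge_entropy (fun c => (k c)%:R / n%:R) (fun i e => (W i e)%:R / n%:R)|
  <= (r%:R + 2 * r%:R * #|C|%:R + r%:R * #|{: C * C}|%:R) * (1 + ln n%:R).
Proof.
move=> r0 n0 kn W1 W2; have := card_edge_models r0 kn W1 W2.
set cnt := #|_|; set A := (\prod_i _)%N; set B := (\prod_c _)%N => Ecnt.
have A0 : (0 < A)%N.
  by rewrite prodn_gt0 // => i; rewrite prodn_gt0 // => e; rewrite fact_gt0.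
have B0 : (0 < B)%N by rewrite prodn_gt0 // => c; rewrite fact_gt0.
have cnt0 : (0 < cnt)%N.
  have : (0 < cnt * A * B)%N by rewrite Ecnt muln_gt0 fact_gt0 expn_gt0 B0.
  by rewrite !muln_gt0 => /andP[/andP[]].
have nf0 : 0 < n`!%:R :> R by rewrite ltr0n fact_gt0.
split; first by rewrite divr_gt0 ?exprn_gt0 // ltr0n.
pose L := @lnfact R; set l := 1 + ln _.
have LA : ln (A%:R : R) = \sum_i \sum_e L (W i e).
  rewrite /A ln_prodn => [|i]; last by rewrite prodn_gt0 // => e; rewrite fact_gt0.
  by apply: eq_bigr => i _; rewrite ln_prodn // => e; rewrite fact_gt0.
have LB : ln (B%:R : R) = \sum_c L (k c) by rewrite /B ln_prodn // => c; rewrite fact_gt0.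
have E1 : ln (cnt%:R : R) + ln (A%:R : R) + ln (B%:R : R) =
   L n + 2 * r%:R * ln (B%:R : R).
  move: (congr1 (fun m => ln (m%:R : R)) Ecnt).
  rewrite /= !natrM natrX !lnM ?posrE ?mulr_gt0 ?exprn_gt0 ?ltr0n ?fact_gt0 //.
  by rewrite lnXn ?ltr0n // => ->; rewrite -[_ *+ (2 * r)%N]mulr_natl natrM.
rewrite ln_div ?posrE ?exprn_gt0 ?ltr0n ?fact_gt0 // lnXn // -[_ *+ r]mulr_natl -/(L n).
have nR : 0 < n%:R :> R by rewrite ltr0n.
pose D m : R := L m - (m%:R * ln m%:R - m%:R).
have l1 : 1 <= l by rewrite /l lerDl ln_ge0 // ler1n.
have D0 m : (m <= n)%N -> 0 <= D m <= l.
  move=> mn; have /andP[d0 d1] := stirling_bounds R m.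
  rewrite d0 /= (le_trans d1) // /l lerD2l.
  case: m mn {d0 d1} => [|m] mn; first by rewrite ln0 // ln_ge0 // ler1n.
  by rewrite ler_ln ?posrE ?ltr0n // ler_nat.
have LE m : L m = D m - n%:R * eta (m%:R / n%:R) + m%:R * (ln n%:R - 1).
  rewrite /D /eta; case: m => [|m].
    by rewrite !mul0r; ring.
  rewrite ln_div ?posrE ?ltr0n //; field; by rewrite gt_eqF.
have kle c : (k c <= n)%N by rewrite -kn (bigD1 c) //= leq_addr.
have Wn i : (\sum_e W i e)%N = n.
  rewrite -kn (partition_big fst predT) //=.
  by apply: eq_bigr => c _; rewrite W1.
have Wle i e : (W i e <= n)%N by rewrite -(Wn i) (bigD1 e) //= leq_addr.
have SB : \sum_c L (k c) =
   \sum_c D (k c) - n%:R * (\sum_c eta ((k c)%:R / n%:R)) + n%:R * (ln n%:R - 1).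
  under eq_bigr => c _ do rewrite LE.
  by rewrite big_split sumrB /= -mulr_sumr -mulr_suml -natr_sum kn.
have SA : \sum_i \sum_e L (W i e) =
   \sum_i \sum_e D (W i e) - n%:R * (\sum_i \sum_e eta ((W i e)%:R / n%:R))
     + r%:R * (n%:R * (ln n%:R - 1)).
  have H i : \sum_e L (W i e) = \sum_e D (W i e)
      - n%:R * (\sum_e eta ((W i e)%:R / n%:R)) + n%:R * (ln n%:R - 1).
    under eq_bigr => c _ do rewrite LE.
    by rewrite big_split sumrB /= -mulr_sumr -mulr_suml -natr_sum Wn.
  under eq_bigr => i _ do rewrite H.
  by rewrite big_split sumrB /= -mulr_sumr sumr_const card_ord -[_ *+ r]mulr_natl.
have DB : 0 <= \sum_c D (k c) <= #|C|%:R * l.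
  rewrite sumr_ge0 /= => [|c _]; last by case/andP: (D0 _ (kle c)).
  apply: le_trans (ler_norm _) _; apply: ler_norm_sum_const => [|c _]; first lra.
  by case/andP: (D0 _ (kle c)) => h1 h2; rewrite ger0_norm.
have DA : 0 <= \sum_i \sum_e D (W i e) <= r%:R * (#|{: C * C}|%:R * l).
  rewrite sumr_ge0 /= => [|i _]; last first.
    by rewrite sumr_ge0 // => e _; case/andP: (D0 _ (Wle i e)).
  apply: le_trans (ler_norm _) _; rewrite -[r in X in _ <= X]card_ord.
  apply: ler_norm_sum_const => [|i _]; first by rewrite mulr_ge0 //; lra.
  apply: ler_norm_sum_const => [|e _]; first lra.
  by case/andP: (D0 _ (Wle i e)) => h1 h2; rewrite ger0_norm.
have Ln : L n = D n + n%:R * (ln n%:R - 1).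
  by rewrite LE divff ?gt_eqF // /eta ln1 mulr0 oppr0 mulr0 subr0.
have r1 : 1 <= r%:R :> R by rewrite ler1n.
have Dn := D0 n (leqnn n).
rewrite LA LB SA SB Ln in E1; rewrite -[ln n`!%:R]/(L n) Ln /edge_entropy.
move: E1 DA DB Dn.
move: (\sum_i \sum_e D _) (\sum_c D _) (\sum_c eta _) (\sum_i \sum_e eta _).
move: (ln cnt%:R) (D n) (ln (n%:R : R) - 1) => x Dn u ZA ZB eB eA E1.
move=> /andP[A1 A2] /andP[B1 B2] /andP[D1 D2].
have -> : x - r%:R * (Dn + n%:R * u) - n%:R * ((1 - 2 * r%:R) * eB + eA) =
  (1 - r%:R) * Dn + (2 * r%:R - 1) * ZB - ZA.
  apply/eqP; rewrite -subr_eq0; apply/eqP.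
  transitivity (x + (ZA - n%:R * eA + r%:R * (n%:R * u)) + (ZB - n%:R * eB + n%:R * u)
   - (Dn + n%:R * u + 2 * r%:R * (ZB - n%:R * eB + n%:R * u))); first by ring.
  by rewrite E1 subrr.
set c := #|C|%:R in B2 *; set cc := #|{: C * C}|%:R in A2 *.
have c0 : 0 <= c * l by apply: le_trans B2.
have h1 : (r%:R - 1) * Dn <= r%:R * l by nra.
have h2 : (2 * r%:R - 1) * ZB <= 2 * r%:R * (c * l) by nra.
have h3 : 0 <= (r%:R - 1) * Dn by rewrite mulr_ge0 // subr_ge0.
have h4 : 0 <= (2 * r%:R - 1) * ZB by rewrite mulr_ge0 // subr_ge0; lra.
have h5 : 0 <= r%:R * l by rewrite mulr_ge0 //; lra.
have h6 : 0 <= r%:R * (c * l) by rewrite mulr_ge0.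
by rewrite ler_norml; apply/andP; split; lra.
Qed.

Lemma fiber_card_le n (C : eqType) (f : 'I_n -> C) c : (fiber_card f c <= n)%N.
Proof. by rewrite -[leqRHS]card_ord; exact: max_card. Qed.

Definition near_models (R : realType) (r n : nat) (C : finType)
    (P : 'I_r -> C * C -> R) (eps : R) :=
  [pred x : {ffun 'I_r -> 'S_n} * {ffun 'I_n -> C} |
     [forall i, [forall e,
       `|(fiber_card (edge_label x.2 (x.1 i)) e)%:R / n%:R - P i e| <= eps]]].

(** Bounds both the Stirling error, in units of 1 + ln n, and the modulus of
edge_entropy, in units of 3 sqrt e. *)
Definition model_error (R : realType) (r : nat) (C : finType) : R :=
  r%:R + 2 * r%:R * #|C|%:R + r%:R * #|{: C * C}|%:R.

Lemma ratio01 (R : realType) (k n : nat) : (k <= n)%N ->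
  0 <= (k%:R / n%:R : R) <= 1.
Proof.
case: n => [|n] kn; first by rewrite invr0 mulr0 lexx ler01.
by rewrite divr_ge0 // ler_pdivrMr ?ltr0n // mul1r ler_nat.
Qed.

(** Group the models by their edge counts W: there are at most
(n+1)^(r #|C|^2) of them, and each W that occurs has equal marginals, so that
ln_card_edge_models applies to it. *)
Lemma card_near_models_le (R : realType) (r n : nat) (C : finType)
    (p : C -> R) (P : 'I_r -> C * C -> R) (eps : R) :
  (0 < r)%N -> (0 < n)%N -> 0 <= eps ->
  (forall c, 0 <= p c <= 1) -> (forall i e, 0 <= P i e <= 1) ->
  (forall i c, \sum_(e : C * C | e.1 == c) P i e = p c) ->
  #|near_models n P eps|%:R / n`!%:R ^+ r <=
  n.+1%:R ^+ (r * #|{: C * C}|) *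
  expR (n%:R * (edge_entropy p P
          + model_error R r C * (3 * Num.sqrt (#|{: C * C}|%:R * eps + eps)))
        + model_error R r C * (1 + ln n%:R)) :> R.
Proof.
move=> r0 n0 e0 p01 P01 P1.
set B := expR _.
have nf0 : 0 < n`!%:R ^+ r :> R by rewrite exprn_gt0 // ltr0n fact_gt0.
pose wt (x : {ffun 'I_r -> 'S_n} * {ffun 'I_n -> C}) :
    {ffun 'I_r * (C * C) -> 'I_n.+1} :=
  [ffun ie => inord (fiber_card (edge_label x.2 (x.1 ie.1)) ie.2)].
rewrite -sum1_card (partition_big wt predT) //= natr_sum mulr_suml.
(* The bound is a sum over all possible W, so it can be checked for each W. *)
have -> : n.+1%:R ^+ (r * #|{: C * C}|) * B =
    \sum_(W : {ffun 'I_r * (C * C) -> 'I_n.+1}) B.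
  by rewrite sumr_const card_ffun !card_prod !card_ord -[RHS]mulr_natl natrX.
apply: ler_sum => W _.
pose S := [pred x | near_models n P eps x && (wt x == W)].
rewrite sum1_card -[#|_|]/#|S|.
have [/eqP|/card_gt0P[x0]] := posnP #|S|.
  by move=> /eqP ->; rewrite mul0r expR_ge0.
rewrite inE /= => /andP[/forallP x0near /eqP x0W].
pose k c := fiber_card x0.2 c.
pose w i e := fiber_card (edge_label x0.2 (x0.1 i)) e.
have kn : (\sum_c k c)%N = n by rewrite sum_fiber_card card_ord.
have w1 i c : (\sum_(e : C * C | e.1 == c) w i e)%N = k c by exact: edge_label_src.
have w2 i c : (\sum_(e : C * C | e.2 == c) w i e)%N = k c by exact: edge_label_tgt.
have [cnt0 cntP] := ln_card_edge_models R r0 n0 kn w1 w2.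
have SE : (#|S| <= #|edge_models n w|)%N.
  apply: subset_leq_card; apply/fintype.subsetP => x; rewrite !inE => /andP[_ /eqP xW].
  apply/forallP => i; apply/forallP => e.
  have : wt x (i, e) = wt x0 (i, e) by rewrite xW x0W.
  rewrite !ffunE /= => /(congr1 val) /=.
  by rewrite !inordK ?ltnS ?fiber_card_le // => ->.
apply: le_trans (_ : #|edge_models n w|%:R / n`!%:R ^+ r <= _).
  by rewrite ler_pM2r ?invr_gt0 // ler_nat.
rewrite -[leLHS]lnK ?posrE // ler_expR.
move: cntP; set x := ln _; rewrite -/(model_error R r C).
set e' := edge_entropy _ _; set err := model_error _ _ _ * (1 + _) => cntP.
have ee : `|e' - edge_entropy p P| <=
   model_error R r C * (3 * Num.sqrt (#|{: C * C}|%:R * eps + eps)).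
  apply: le_trans
    (edge_entropy_modulus (e := #|{: C * C}|%:R * eps + eps) r0 _ _ _ _ _ _) _ => //.
  - by move=> c; apply: ratio01; exact: fiber_card_le.
  - by move=> i e; apply: ratio01; exact: fiber_card_le.
  (* Vertex frequencies are marginals of edge frequencies; rank r >= 1 provides
     an edge direction. *)
  - move=> c; pose i := Ordinal r0.
    rewrite -(P1 i) -(w1 i) natr_sum mulr_suml -sumrB.
    apply: le_trans (ler_norm_sum_const e0 _) _; last by rewrite lerDl.
    by move=> e _; have /forallP/(_ e) := x0near i.
  - move=> i e; have /forallP/(_ e) := x0near i => /le_trans; apply.
    by rewrite lerDr mulr_ge0.
  - rewrite ler_wpM2r // ?mulr_ge0 ?sqrtr_ge0 //.
    by rewrite /model_error -addrA lerDr.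
have nR : 0 <= n%:R :> R by rewrite ler0n.
have {ee} : n%:R * e' <= n%:R * (edge_entropy p P +
    model_error R r C * (3 * Num.sqrt (#|{: C * C}|%:R * eps + eps))).
  rewrite ler_wpM2l //; move: ee; rewrite ler_norml => /andP[_]; lra.
move: cntP; rewrite ler_norml => /andP[_]; lra.
Qed.

Lemma log_sublinear (R : realType) (K delta : R) : 0 <= K -> 0 < delta ->
  exists N, forall n, (N < n)%N -> K * (1 + ln n.+1%:R) <= delta * n%:R.
Proof.
move=> K0 d0; exists (Num.bound ((6 * K / delta) ^+ 2)) => n Nn.
have n1 : 1 <= n%:R :> R by rewrite ler1n (leq_ltn_trans _ Nn).
have nS : n.+1%:R = n%:R + 1 :> R by rewrite natr1.
have S0 : 0 < n.+1%:R :> R by rewrite ltr0n.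
have := ln_le_2sqrt S0; set s := Num.sqrt _ => lns.
have s0 : 0 <= s := sqrtr_ge0 _.
have ss : s * s = n%:R + 1 by rewrite -expr2 sqr_sqrtr ?ltW // nS.
have s1 : 1 <= s by nra.
have q0 : 0 <= 6 * K / delta by rewrite divr_ge0 ?mulr_ge0 // ltW.
have sq : 6 * K / delta <= s.
  rewrite -(ler_pXn2r (_ : 0 < 2)%N) ?nnegrE // [leRHS]expr2 ss -nS.
  apply: ltW; apply: lt_trans (archi_boundP _) _; first exact: sqr_ge0.
  by rewrite ltr_nat ltnS ltnW.
have dK : 6 * K <= delta * s by rewrite [leRHS]mulrC -ler_pdivrMr.
have : K * (1 + ln n.+1%:R) <= K * (3 * s) by rewrite ler_wpM2l //; lra.
move=> /le_trans; apply.
have : 6 * K * s <= delta * s * s by rewrite ler_wpM2r.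
rewrite -[X in _ <= X]mulrA ss; nra.
Qed.

(** The tolerance eps comes from the modulus of continuity and N from the
sublinearity of the logarithmic terms; each takes half of delta. *)
Lemma near_models_upper (R : realType) (r : nat) (C : finType)
    (p : C -> R) (P : 'I_r -> C * C -> R) (delta : R) :
  (0 < r)%N -> 0 < delta ->
  (forall c, 0 <= p c <= 1) -> (forall i e, 0 <= P i e <= 1) ->
  (forall i c, \sum_(e : C * C | e.1 == c) P i e = p c) ->
  exists eps : R, exists N : nat, 0 < eps /\ forall n, (N < n)%N ->
  #|near_models n P eps|%:R / n`!%:R ^+ r <=
  expR (n%:R * (edge_entropy p P + delta)) :> R.
Proof.
move=> r0 d0 p01 P01 P1.
pose K := model_error R r C.
have K0 : 0 <= K by rewrite /K /model_error !addr_ge0 ?mulr_ge0.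
pose q : R := #|{: C * C}|%:R + 1.
have q0 : 0 < q by rewrite ltr_wpDl.
pose t := delta / 2 / (3 * K + 1).
have K1 : 0 < 3 * K + 1 by lra.
have t0 : 0 < t by rewrite !divr_gt0.
pose eps := t ^+ 2 / q.
have eps0 : 0 < eps by rewrite divr_gt0 // exprn_gt0.
have epst : Num.sqrt (#|{: C * C}|%:R * eps + eps) = t.
  rewrite -[X in _ + X]mul1r -mulrDl -/q /eps mulrCA divff ?gt_eqF // mulr1.
  by rewrite sqrtr_sqr gtr0_norm.
have Kt : K * (3 * t) <= delta / 2.
  have : t * (3 * K + 1) = delta / 2 by rewrite /t mulfVK // gt_eqF.
  lra.
pose m := (r * #|{: C * C}|)%N.
have Km0 : 0 <= m%:R + K by rewrite addr_ge0.
have d2 : 0 < delta / 2 by rewrite divr_gt0.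
have [N HN] := log_sublinear Km0 d2.
exists eps, N; split => // n Nn.
have n0 : (0 < n)%N by exact: leq_ltn_trans Nn.
apply: le_trans (card_near_models_le r0 n0 (ltW eps0) p01 P01 P1) _.
rewrite -/K -/m epst.
have -> : n.+1%:R ^+ m = expR (m%:R * ln n.+1%:R) :> R.
  by rewrite expRM_natl lnK // posrE ltr0n.
rewrite -expRD ler_expR.
have lnn : ln n%:R <= ln n.+1%:R :> R by rewrite ler_ln ?posrE ?ltr0n // ler_nat.
have l0 : 0 <= ln (n.+1%:R : R) by rewrite ln_ge0 // ler1n.
have h1 : K * (1 + ln n%:R) <= K * (1 + ln n.+1%:R) by rewrite ler_wpM2l // lerD2l.
have h2 : n%:R * (K * (3 * t)) <= n%:R * (delta / 2) by rewrite ler_wpM2l.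
have h3 : 0 <= m%:R :> R by rewrite ler0n.
have := HN n Nn; move: h1 h2 h3; clear.
move: (m%:R : R) K t (ln (n.+1%:R : R)) (ln (n%:R : R)) (n%:R : R) (edge_entropy p P).
by move=> M {}K {}t a b c e; nra.
Qed.

(** The weights of integer_circulation have exactly equal marginals, so the exact
count applies to them.  Such n are only known to be arbitrarily large, which is
what a limsup needs. *)
Lemma edge_models_lower (R : realType) (r : nat) (C : finType)
    (p : C -> R) (P : 'I_r -> C * C -> R) (delta eps : R) (N : nat) :
  (0 < r)%N -> 0 < delta -> 0 < eps ->
  (forall c, 0 <= p c <= 1) -> (forall i e, 0 <= P i e <= 1) ->
  \sum_c p c = 1 ->
  (forall i c, \sum_(e : C * C | e.1 == c) P i e = p c) ->
  (forall i c, \sum_(e : C * C | e.2 == c) P i e = p c) ->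
  exists n : nat, exists W : 'I_r -> C * C -> nat, exists k : C -> nat,
  [/\ (N < n)%N, forall i c, (\sum_(e : C * C | e.1 == c) W i e)%N = k c,
      forall i e, P i e = 0 -> W i e = 0%N,
      forall c, `|(k c)%:R / n%:R - p c| <= eps &
      expR (n%:R * (edge_entropy p P - delta)) <=
        #|edge_models n W|%:R / n`!%:R ^+ r :> R].
Proof.
move=> r0 d0 e0 p01 P01 p1 P1 P2.
pose K := model_error R r C.
have K0 : 0 <= K by rewrite /K /model_error !addr_ge0 ?mulr_ge0.
have K1 : 0 < 3 * K + 1 by lra.
pose t := delta / 2 / (3 * K + 1).
have t0 : 0 < t by rewrite !divr_gt0.
pose e1 := Num.min eps (t ^+ 2).
have e10 : 0 < e1 by rewrite lt_min e0 exprn_gt0.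
have st : Num.sqrt e1 <= t.
  rewrite -[leRHS]gtr0_norm // -sqrtr_sqr ler_wsqrtr //.
  by rewrite /e1 ge_min lexx orbT.
have Kt : K * (3 * t) <= delta / 2.
  have : t * (3 * K + 1) = delta / 2 by rewrite /t mulfVK // gt_eqF.
  lra.
have d2 : 0 < delta / 2 by rewrite divr_gt0.
have [N1 HN1] := log_sublinear K0 d2.
have [|i e|n [W [k [Nn kn W1 W2 [W0 WP kp]]]]] :=
    integer_circulation (maxn N N1) e10 _ _ p1 P1 P2.
- by move=> c; case/andP: (p01 c).
- by case/andP: (P01 i e).
move: Nn; rewrite gtn_max => /andP[Nn N1n].
exists n, W, k; split => //.
  by move=> c; apply: le_trans (kp c) _; rewrite /e1 ge_min lexx.
have n0 : (0 < n)%N by exact: leq_ltn_trans Nn.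
have [cnt0 cntP] := ln_card_edge_models R r0 n0 kn W1 W2.
rewrite -[leRHS]lnK ?posrE // ler_expR.
move: cntP; set x := ln _; rewrite -/(model_error R r C) -/K.
set e' := edge_entropy _ _; rewrite ler_norml => /andP[cntP _].
have kle c : (k c <= n)%N by rewrite -kn (bigD1 c) //= leq_addr.
have Wn i : (\sum_e W i e)%N = n.
  rewrite -kn (partition_big fst predT) //=.
  by apply: eq_bigr => c _; rewrite W1.
have Wle i e : (W i e <= n)%N by rewrite -(Wn i) (bigD1 e) //= leq_addr.
have : `|e' - edge_entropy p P| <= K * (3 * Num.sqrt e1).
  apply: le_trans (edge_entropy_modulus (e := e1) r0 _ _ _ _ _ _) _ => //.
  - by move=> c; exact: ratio01.
  - by move=> i e; exact: ratio01.
  - rewrite ler_wpM2r // ?mulr_ge0 ?sqrtr_ge0 //.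
    by rewrite /K /model_error -addrA lerDr.
rewrite ler_norml => /andP[ee _].
have Kst : K * (3 * Num.sqrt e1) <= delta / 2.
  by apply: le_trans Kt; rewrite ler_wpM2l // ler_wpM2l.
have nR : 0 <= n%:R :> R by rewrite ler0n.
have h : n%:R * (edge_entropy p P - delta / 2) <= n%:R * e'.
  by rewrite ler_wpM2l //; lra.
have lnn : ln n%:R <= ln n.+1%:R :> R by rewrite ler_ln ?posrE ?ltr0n // ler_nat.
have h1 : K * (1 + ln n%:R) <= K * (1 + ln n.+1%:R) by rewrite ler_wpM2l // lerD2l.
have := HN1 n N1n; lra.
Qed.

Local Open Scope classical_set_scope.
Local Open Scope ring_scope.

(** * Homomorphisms to symmetric groups and word balls *)

Lemma sym_homs1 (G : monoidType) n (sigma : G -> 'S_n) :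
  sym_homs G n sigma -> sigma 1%g = 1%g.
Proof. by case=> s1 _; apply/permP => j; rewrite s1 perm1. Qed.

Lemma sym_homsM (G : monoidType) n (sigma : G -> 'S_n) g h :
  sym_homs G n sigma -> sigma (g * h)%g = (sigma h * sigma g)%g.
Proof. by case=> _ sM; apply/permP => j; rewrite sM permM. Qed.

(** The multiplication of permutations is composition in diagrammatic order, so
the letters of the word are multiplied from the right. *)
Definition eval_word (L : Type) n (q : L -> 'S_n) (w : seq L) : 'S_n :=
  foldr (fun x t => (t * q x)%g) 1%g w.

Lemma eval_word_cat (L : Type) n (q : L -> 'S_n) u v :
  eval_word q (u ++ v) = (eval_word q v * eval_word q u)%g.
Proof. by elim: u => [|x u IH] /=; rewrite ?mulg1 // IH mulgA. Qed.

Lemma sym_homs_word (G : monoidType) (L : Type) (l : L -> G) n (sigma : G -> 'S_n) w :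
  sym_homs G n sigma ->
  sigma (\prod_(x <- w) l x)%g = eval_word (sigma \o l) w.
Proof.
move=> hs; elim: w => [|x w IH]; first by rewrite big_nil sym_homs1.
by rewrite big_cons (sym_homsM _ _ hs) IH.
Qed.

Lemma sym_homs_ext (G : monoidType) (L : Type) (l : L -> G) n (sigma tau : G -> 'S_n) :
  (forall g, exists w : seq L, (\prod_(x <- w) l x)%g = g) ->
  sym_homs G n sigma -> sym_homs G n tau ->
  (forall x, sigma (l x) = tau (l x)) -> sigma = tau.
Proof.
move=> gen hs ht st; apply/funext => g; have [w <-] := gen g.
rewrite (sym_homs_word _ _ hs) (sym_homs_word _ _ ht).
by elim: w => //= x w ->; rewrite st.
Qed.

(** The universal property from normal forms: if every word has a normal form nf
with the same value in G and in Sym(n), then evaluating the normal form of g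
is a homomorphism, since the normal form of g h and the concatenation of those
of g and h have the same value. *)
Lemma sym_homs_exists (G : monoidType) (L : Type) (l : L -> G) n (q : L -> 'S_n)
    (nf : seq L -> Prop) :
  (forall g, exists! w, nf w /\ (\prod_(x <- w) l x)%g = g) ->
  (forall w, exists2 w', nf w' & (\prod_(x <- w) l x)%g = (\prod_(x <- w') l x)%g /\
      eval_word q w = eval_word q w') ->
  exists2 sigma, sym_homs G n sigma & forall x, sigma (l x) = q x.
Proof.
move=> uniqw red.
have /choice[wd wdP] : forall g, exists w, nf w /\ (\prod_(x <- w) l x)%g = g.
  by move=> g; have [w [wP _]] := uniqw g; exists w.
have wdE w : eval_word q (wd (\prod_(x <- w) l x)%g) = eval_word q w.
  have [w' nw' [ww' ->]] := red w; congr eval_word.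
  have [v [_ vu]] := uniqw (\prod_(x <- w) l x)%g.
  by rewrite -(vu w') // -(vu (wd _)).
exists (fun g => eval_word q (wd g)).
  split => [j|g h j].
    by have := wdE [::]; rewrite big_nil => ->; rewrite perm1.
  have := wdE (wd g ++ wd h).
  rewrite big_cat /= (wdP g).2 (wdP h).2 => ->.
  by rewrite eval_word_cat permM.
by move=> x; have := wdE [:: x]; rewrite big_seq1 /= mul1g.
Qed.

(** What the proof uses of a free group or free semigroup.  The last condition
lets one walk through a word ball with right multiplications by the s_i only,
an inverse letter being a step backwards; it makes no reference to inverses, so
that it makes sense in a monoid. *)
Definition free_system (r : nat) (G : monoidType) (s : 'I_r -> G) (S : set G) : Prop :=
  [/\ forall n (p : 'I_r -> 'S_n),
        exists2 sigma, sym_homs G n sigma & forall i, sigma (s i) = p i,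
      forall n (sigma tau : G -> 'S_n), sym_homs G n sigma -> sym_homs G n tau ->
        (forall i, sigma (s i) = tau (s i)) -> sigma = tau,
      forall g, exists m, word_ball S m g,
      finite_set S &
      forall x, S x -> exists i, x = s i \/ (x * s i)%g = 1%g].

Lemma free_semigroup_system (r : nat) (G : monoidType) (s : 'I_r -> G) :
  free_semigroup_on s -> free_system s (semigroup_generators s).
Proof.
move=> fs.
have gen g : exists w : seq 'I_r, (\prod_(x <- w) s x)%g = g.
  by have [w [wg _]] := fs g; exists w.
split.
- move=> n p; apply: (@sym_homs_exists G _ s n p (fun=> True)) => [g|w]; last by exists w.
  have [w [wg wu]] := fs g; exists w; split => // v [_]; exact: wu.
- by move=> n sigma tau hs ht st; apply: (sym_homs_ext gen).
- move=> g; have [w <-] := gen g; exists (size w), [seq s i | i <- w]; split.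
  + by rewrite size_map.
  + by move=> x /mapP[i _ ->]; exists i.
  + by rewrite big_map.
- have -> : semigroup_generators s = [set s i | i in [set: 'I_r]].
    apply/seteqP; split => g [i]; first by move=> ->; exists i.
    by move=> _ <-; exists i.
  exact: finite_image.
- by move=> x [i ->]; exists i; left.
Qed.

Definition inv_letter (r : nat) (x : 'I_r * bool) : 'I_r * bool := (x.1, ~~ x.2).

Definition cons_reduced (r : nat) (x : 'I_r * bool) (w : seq ('I_r * bool)) :=
  if w is y :: w' then if y == inv_letter x then w' else x :: w else [:: x].

Definition reduction (r : nat) (w : seq ('I_r * bool)) := foldr (@cons_reduced r) [::] w.

(** Cancelling letters from the right produces reduced words, without changing
the value in any group (prod_reduction, eval_reduction); this is the normal
form used for free groups. *)
Lemma reduction_reduced r (w : seq ('I_r * bool)) : reduced (reduction w).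
Proof.
elim: w => //= x w; rewrite /reduced; case: (reduction w) => //= y w' IH.
case: ifP => [_|yx]; first exact: path_sorted IH.
by rewrite /= IH andbT; apply: negbT.
Qed.

Lemma prod_reduction r (G : groupType) (s : 'I_r -> G) w :
  (\prod_(x <- reduction w) letter s x)%g = (\prod_(x <- w) letter s x)%g.
Proof.
elim: w => //= x w IH; rewrite big_cons -{}IH /cons_reduced.
case: (reduction w) => [|y w']; first by rewrite big_seq1 big_nil mulg1.
rewrite big_cons; case: eqP => [->|_]; last by rewrite !big_cons.
by rewrite mulgA /letter /=; case: x.2; rewrite /= ?mulgV ?mulVg mul1g.
Qed.

Lemma eval_reduction r n (p : 'I_r -> 'S_n) w :
  eval_word (letter p) (reduction w) = eval_word (letter p) w.
Proof.
elim: w => //= x w <-; rewrite /cons_reduced.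
case: (reduction w) => [|y w'] //=; case: eqP => //= ->.
by rewrite -mulgA /letter /=; case: x.2; rewrite /= ?mulgV ?mulVg mulg1.
Qed.

Lemma free_group_system (r : nat) (G : groupType) (s : 'I_r -> G) :
  free_group_on s -> free_system s (group_generators s).
Proof.
move=> fs.
have gen g : exists w : seq ('I_r * bool), (\prod_(x <- w) letter s x)%g = g.
  by have [w [[_ wg] _]] := fs g; exists w.
split.
- move=> n p.
  have [||sigma hs sp] :=
    @sym_homs_exists G _ (letter s) n (letter p) (fun w => reduced w).
  + exact: fs.
  + move=> w; exists (reduction w); first exact: reduction_reduced.
    by rewrite prod_reduction eval_reduction.
  + by exists sigma => // i; have := sp (i, true).
- move=> n sigma tau hs ht st; apply: (sym_homs_ext gen) => // -[i b].
  rewrite /letter /=.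
  have inv (f : G -> 'S_n) : sym_homs G n f -> f (s i)^-1%g = (f (s i))^-1%g.
    move=> hf; apply/eqP; rewrite eq_sym eq_invg_mul -(sym_homsM _ _ hf).
    by rewrite mulVg sym_homs1.
  by case: b; rewrite ?(inv sigma) ?(inv tau) ?st.
- move=> g; have [w <-] := gen g; exists (size w), [seq letter s i | i <- w]; split.
  + by rewrite size_map.
  + by move=> x /mapP[[i b] _ ->]; exists i; rewrite /letter; case: b; [left|right].
  + by rewrite big_map.
- have -> : group_generators s = [set letter s x | x in [set: 'I_r * bool]].
    apply/seteqP; split => g.
      by move=> [i [->|->]]; [exists (i, true)|exists (i, false)].
    by move=> [[i b] _ <-]; exists i; rewrite /letter; case: b; [left|right].
  exact: finite_image.
- by move=> x [i [->|->]]; exists i; [left|right; rewrite mulVg].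
Qed.

Lemma word_ball1 (G : monoidType) (S : set G) m : word_ball S m 1%g.
Proof. by exists [::]; split => //; rewrite big_nil. Qed.

Lemma word_ball_mono (G : monoidType) (S : set G) m m' :
  (m <= m')%N -> word_ball S m `<=` word_ball S m'.
Proof. by move=> mm g [w [sw Sw wg]]; exists w; split => //; exact: leq_trans mm. Qed.

(** A word is decomposed at its last letter, because the edges of the name
process are g |-> g s_i: the name of T_(s_i) x at g is that of x at g s_i. *)
Lemma word_ballS (G : monoidType) (S : set G) m h : word_ball S m.+1 h ->
  h = 1%g \/ exists g x, [/\ word_ball S m g, S x & h = (g * x)%g].
Proof.
move=> [w]; case/lastP: w => [|w x] [sw Sw <-]; first by left; rewrite big_nil.
right; exists (\prod_(y <- w) y)%g, x; split.
- by exists w; split => //; [rewrite size_rcons in sw|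
    move=> y yw; apply: Sw; rewrite mem_rcons inE yw orbT].
- by apply: Sw; rewrite mem_rcons inE eqxx.
- by rewrite -cats1 big_cat big_seq1.
Qed.

Lemma word_ball0 (G : monoidType) (S : set G) h : word_ball S 0 h -> h = 1%g.
Proof. by move=> [[|x w] [//= _ _ <-]]; rewrite big_nil. Qed.

Lemma word_ball_finite (G : monoidType) (S : set G) m :
  finite_set S -> finite_set (word_ball S m).
Proof.
move=> fS; elim: m => [|m IH].
  by apply: sub_finite_set (finite_set1 1%g) => h /word_ball0.
apply: (@sub_finite_set _ _
  ([set 1%g] `|` [set (g * x)%g | g in word_ball S m & x in S])).
  move=> h /word_ballS[->|[g [x [mg Sx ->]]]]; first by left.
  by right; exists g => //; exists x.
by rewrite finite_setU; split; [exact: finite_set1|exact: finite_image2].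
Qed.

Lemma free_system_exhaust (r : nat) (G : monoidType) (s : 'I_r -> G) (S : set G)
    (H : {fset G}) : free_system s S ->
  exists m, forall g, g \in H -> word_ball S m g.
Proof.
case=> _ _ tot _ _; have /choice[rad radP] := tot.
exists (\max_(g <- H) rad g)%N => g gH; apply: word_ball_mono (radP g).
exact: leq_bigmax_seq.
Qed.

(** * Laws of finite observables and the functional F *)

Lemma fsbig_pred (R : Type) (idx : R) (op : Monoid.com_law idx) (C : finType)
    (Q : pred C) (F : C -> R) :
  \big[op/idx]_(c \in [set c | Q c]) F c = \big[op/idx]_(c | Q c) F c.
Proof.
rewrite (bigfs op (P := Q)) //; first exact: index_enum_uniq.
by move=> c _; rewrite mem_index_enum.
Qed.

Lemma fsbig_setT_fintype (R : Type) (idx : R) (op : Monoid.com_law idx) (C : finType)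
    (F : C -> R) :
  \big[op/idx]_(c \in [set: C]) F c = \big[op/idx]_c F c.
Proof.
rewrite -(@fsbig_pred R idx op C predT F).
by congr (\big[op/idx]_(c \in _) F c); apply/seteqP; split.
Qed.

Section Law.
Context (R : realType) (d : measure_display) (X : measurableType d)
  (mu : probability X R).

Definition law (C : finType) (Phi : X -> C) (c : C) : R := fine (mu (Phi @^-1` [set c])).

Lemma finite_observable_comp (C D : finType) (Phi : X -> C) (h : C -> D) :
  finite_observable Phi -> finite_observable (h \o Phi).
Proof. by move=> mPhi B; rewrite comp_preimage; exact: mPhi. Qed.

Lemma finite_observable_fibers (C : finType) (Phi : X -> C) :
  (forall c, measurable (Phi @^-1` [set c])) -> finite_observable Phi.
Proof.
move=> mPhi B.
have -> : Phi @^-1` B = \bigcup_(c in B) Phi @^-1` [set c].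
  apply/seteqP; split => x; first by move=> Bx; exists (Phi x).
  by move=> [c Bc /= ->].
by apply: fin_bigcup_measurable => //; exact: finite_finset.
Qed.

Lemma mu_law (C : finType) (Phi : X -> C) c :
  finite_observable Phi -> mu (Phi @^-1` [set c]) = (law Phi c)%:E.
Proof. by move=> mPhi; rewrite /law fineK // fin_num_measure. Qed.

Lemma law01 (C : finType) (Phi : X -> C) c : finite_observable Phi -> 0 <= law Phi c <= 1.
Proof.
move=> mPhi; rewrite -!lee_fin -mu_law // measure_ge0 /=.
exact: probability_le1.
Qed.

Lemma law_sum (C D : finType) (Phi : X -> C) (Psi : X -> D) (h : C -> D) e :
  finite_observable Phi -> (forall x, h (Phi x) = Psi x) ->
  \sum_(c | h c == e) law Phi c = law Psi e.
Proof.
move=> mPhi hPhi; apply: EFin_inj; rewrite -mu_law; last first.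
  have -> : Psi = h \o Phi by apply/funext => x; rewrite /= hPhi.
  exact: finite_observable_comp.
have -> : Psi @^-1` [set e] = \bigcup_(c in [set c | h c == e]) Phi @^-1` [set c].
  apply/seteqP; split => x /=.
    by move=> <-; exists (Phi x) => //=; rewrite hPhi eqxx.
  by move=> [c /= /eqP <- <-]; rewrite hPhi.
rewrite measure_fin_bigcup //.
- rewrite fsbig_pred -sumEFin; apply: eq_bigr => c _.
  exact/esym/mu_law.
- exact: finite_finset.
- by move=> c c' _ _ [x [/= -> ->]].
Qed.

Lemma law_total (C : finType) (Phi : X -> C) : finite_observable Phi ->
  \sum_c law Phi c = 1.
Proof.
move=> mPhi; transitivity (\sum_(c | tt == tt) law Phi c); first exact: eq_bigl.
rewrite (@law_sum _ unit Phi (fun=> tt) (fun=> tt)) //.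
rewrite /law (_ : _ @^-1` _ = setT) ?probability_setT //.
by apply/seteqP; split.
Qed.

(** Colours with empty fibre all give the same cell, the empty set; it
contributes 0, and the other colours index the cells faithfully. *)
Lemma shannon_observable (C : finType) (Phi : X -> C) : finite_observable Phi ->
  shannon mu [set Phi @^-1` [set c] | c in [set: C]] = (\sum_c eta (law Phi c))%:E.
Proof.
move=> mPhi; rewrite /shannon esum_fset; last 2 first.
- by apply: finite_image; exact: finite_finset.
- move=> P; rewrite inE => -[c _ <-]; rewrite lee_fin -/(law Phi c).
  exact/eta_ge0/law01.
pose E c := Phi @^-1` [set c].
pose D := [set c | E c !=set0].
rewrite -(fsbig_widen (E @` D)); last 2 first.
- by move=> _ [c _ <-]; exists c.
- move=> P [[c _ <-] ncP]; rewrite /= (_ : Phi @^-1` [set c] = set0).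
    by rewrite measure0 /= mul0r oppr0.
  by apply/eqP/negPn/negP => /set0P c0; apply: ncP; exists c.
rewrite fsbig_image; last first.
  move=> c c'; rewrite !inE => -[x xc] _ cc'.
  have : E c' x by rewrite -cc'.
  by move: xc; rewrite /E /= => -> ->.
rewrite (fsbig_widen D [set: C]) //; last first.
  move=> c [_ Dc]; rewrite /= (_ : E c = set0).
    by rewrite measure0 /= mul0r oppr0.
  by apply/eqP/negPn/negP => /set0P c0; apply: Dc.
by rewrite fsbig_setT_fintype sumEFin.
Qed.

End Law.

(** The L1 distance does not increase under pushforward; this is how closeness
on a larger window of G is passed to names or edges on a smaller one. *)
Lemma pushforward_dist (R : realType) (C D : finType) (h : C -> D) (u v : C -> R)
    (u' v' : D -> R) :
  (forall d, \sum_(c | h c == d) u c = u' d) ->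
  (forall d, \sum_(c | h c == d) v c = v' d) ->
  \sum_d `|u' d - v' d| <= \sum_c `|u c - v c|.
Proof.
move=> hu hv; rewrite [leRHS](partition_big h predT) //=.
apply: ler_sum => d _; rewrite -hu -hv -sumrB.
exact: ler_norm_sum.
Qed.

Section Observables.
Context (R : realType) (d : measure_display) (X : measurableType d) (mu : probability X R)
  (G : monoidType) (T : G -> X -> X) (A : finType) (phi : X -> A)
  (hT : mp_action mu T) (hphi : finite_observable phi).

Lemma measurable_preimage_T g E : measurable E -> measurable (T g @^-1` E).
Proof.
case: hT => _ _ mT _ mE.
by rewrite -[_ @^-1` _]setTI; apply: mT => //; exact: measurableT.
Qed.

Lemma obs_name_observable (H : {fset G}) : finite_observable (obs_name T phi H).
Proof.
apply: finite_observable_fibers => a.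
have -> : obs_name T phi H @^-1` [set a] =
    \bigcap_(h in [set: H]) (T (val h) @^-1` (phi @^-1` [set a h])).
  apply/seteqP; split => x /=.
    by move=> xa h _ /=; rewrite -xa /obs_name ffunE.
  by move=> xa; apply/ffunP => h; rewrite /obs_name ffunE; exact: xa.
apply: fin_bigcap_measurable; first exact: finite_finset.
by move=> h _; exact: measurable_preimage_T.
Qed.

Definition obs_edge (C : Type) (Phi : X -> C) (g : G) (x : X) : C * C :=
  (Phi x, Phi (T g x)).

Lemma obs_edge_observable (C : finType) (Phi : X -> C) g :
  finite_observable Phi -> finite_observable (obs_edge Phi g).
Proof.
move=> mPhi; apply: finite_observable_fibers => -[a b].
have -> : obs_edge Phi g @^-1` [set (a, b)] =
    Phi @^-1` [set a] `&` T g @^-1` (Phi @^-1` [set b]).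
  by apply/seteqP; split => x /=; rewrite /obs_edge => -[-> ->].
by apply: measurableI => //; exact: measurable_preimage_T.
Qed.

Lemma law_edge_src (C : finType) (Phi : X -> C) g c : finite_observable Phi ->
  \sum_(e : C * C | e.1 == c) law mu (obs_edge Phi g) e = law mu Phi c.
Proof. by move=> mPhi; apply: law_sum => //; exact: obs_edge_observable. Qed.

Lemma law_edge_tgt (C : finType) (Phi : X -> C) g c : finite_observable Phi ->
  \sum_(e : C * C | e.2 == c) law mu (obs_edge Phi g) e = law mu Phi c.
Proof.
move=> mPhi; rewrite (@law_sum _ _ _ _ _ _ _ (Phi \o T g)) //; last first.
  exact: obs_edge_observable.
by case: hT => _ _ _ mpT; rewrite /law comp_preimage mpT.
Qed.

(** A choice of one cell for each g in the ball is the same as a name on the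
ball; the equality includes the empty cells, which come from names that no
point has. *)
Lemma ball_refinement_observable (S : set G) n (Hb : finite_set (word_ball S n)) :
  ball_refinement S T [set phi @^-1` [set a] | a in [set: A]] n =
  [set obs_name T phi (fset_set (word_ball S n)) @^-1` [set c]
    | c in [set: {ffun fset_set (word_ball S n) -> A}]].
Proof.
set B := word_ball S n; set H := fset_set B.
have BH g : B g -> g \in H by move=> Bg; rewrite in_fset_set // inE.
have HB (h : H) : B (val h) by have := valP h; rewrite in_fset_set // inE.
apply/seteqP; split => E.
- move=> [P PB <-].
  have /choice[a aP] : forall h : H, exists a,
      P (val h) = T (val h) @^-1` (phi @^-1` [set a]).
    by move=> h; have [_ [a _ <-] <-] := PB _ (HB h); exists a.
  exists [ffun h => a h] => //; apply/seteqP; split => x /=.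
    move=> xa g Bg; have := aP [` BH g Bg]%fset; rewrite /= => ->; rewrite /=.
    by have /ffunP/(_ [` BH g Bg]%fset) := xa; rewrite !ffunE.
  move=> xP; apply/ffunP => h; rewrite !ffunE.
  by have := xP _ (HB h); rewrite aP.
- move=> [c _ <-].
  (* Stated for all h with value g, so that g need not be known to be in H. *)
  exists (fun g => [set x | forall h : H, val h = g -> phi (T g x) = c h]).
    move=> g Bg; exists (phi @^-1` [set c [` BH g Bg]%fset]).
      by exists (c [` BH g Bg]%fset).
    apply/seteqP; split => x /=; last by move=> /(_ [` BH g Bg]%fset); apply.
    move=> e h hg; rewrite e; congr (c _); exact/val_inj.
  apply/seteqP; split => x /=.
    move=> xc; apply/ffunP => h; rewrite ffunE.
    by have := xc _ (HB h); apply.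
  by move=> <- g Bg h <-; rewrite ffunE.
Qed.

Lemma join_observable (C : finType) (Phi : X -> C) g :
  join [set Phi @^-1` [set c] | c in [set: C]]
    (pullback (T g) [set Phi @^-1` [set c] | c in [set: C]]) =
  [set obs_edge Phi g @^-1` [set e] | e in [set: (C * C)%type]].
Proof.
apply/seteqP; split => E.
- move=> [_ [a _ <-]] [_ [_ [b _ <-] <-] <-]; exists (a, b) => //.
  by apply/seteqP; split => x /=; rewrite /obs_edge => -[-> ->].
- move=> [[a b] _ <-]; exists (Phi @^-1` [set a]); first by exists a.
  exists (T g @^-1` (Phi @^-1` [set b])).
    by exists (Phi @^-1` [set b]) => //; exists b.
  by apply/seteqP; split => x /=; rewrite /obs_edge => -[-> ->].
Qed.

Lemma F_observable (r : nat) (s : 'I_r -> G) (C : finType) (Phi : X -> C) :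
  finite_observable Phi ->
  F_functional mu s T [set Phi @^-1` [set c] | c in [set: C]] =
  (edge_entropy (law mu Phi) (fun i => law mu (obs_edge Phi (s i))))%:E.
Proof.
move=> mPhi; rewrite /F_functional shannon_observable //.
rewrite (eq_bigr (fun i => (\sum_e eta (law mu (obs_edge Phi (s i)) e))%:E)).
  by rewrite sumEFin -EFinM -EFinD.
move=> i _; rewrite join_observable shannon_observable //.
exact: obs_edge_observable.
Qed.

End Observables.

(** * The entropy rate over uniform homomorphisms *)

(** Homomorphisms to Sym(n) are r-tuples of permutations. *)
Lemma free_system_homs (r : nat) (G : monoidType) (s : 'I_r -> G) (S : set G) n :
  free_system s S -> exists hom : {ffun 'I_r -> 'S_n} -> G -> 'S_n,
    [/\ forall p, sym_homs G n (hom p), forall p i, hom p (s i) = p i &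
        sym_homs G n = range hom].
Proof.
case=> ext uniq _ _ _.
have /choice[hom homP] : forall p : {ffun 'I_r -> 'S_n}, exists sigma,
    sym_homs G n sigma /\ forall i, sigma (s i) = p i.
  by move=> p; have [sigma h1 h2] := ext n p; exists sigma.
exists hom; split => [p|p i|]; [exact: (homP p).1|exact: (homP p).2|].
apply/seteqP; split => [sigma hs|_ [p _ <-]]; last exact: (homP p).1.
exists [ffun i => sigma (s i)] => //; apply: (uniq n) => //; first exact: (homP _).1.
by move=> i; rewrite (homP _).2 ffunE.
Qed.

(** The expectation over a uniform homomorphism as a finite average over r-tuples
of permutations. *)
Lemma esum_uniform_homs (R : realType) (r : nat) (G : monoidType) (s : 'I_r -> G) n
    (hom : {ffun 'I_r -> 'S_n} -> G -> 'S_n) (g : (G -> 'S_n) -> nat) :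
  (forall p i, hom p (s i) = p i) -> sym_homs G n = range hom ->
  (\esum_(sigma in sym_homs G n) (uniform_homs R G n sigma * (g sigma)%:R)%:E)%E =
  ((\sum_p g (hom p))%N%:R / n`!%:R ^+ r)%:E.
Proof.
move=> hs hr.
have hinj : injective hom.
  by move=> p q pq; apply/ffunP => i; rewrite -!hs pq.
have cardE : #|` fset_set (sym_homs G n)| = (n`! ^ r)%N.
  rewrite hr fset_set_image; last exact: finite_finset.
  rewrite card_imfset //= -(card_Sn n) -[r in RHS](card_ord r) -card_ffun cardE.
  apply: perm_size; apply: uniq_perm; rewrite ?enum_uniq ?fset_uniq //.
  move=> p; rewrite mem_enum in_fset_set; last exact: finite_finset.
  by rewrite inE; exact: mem_set.
rewrite [in LHS]hr esum_image; last by move=> p q _ _; exact: hinj.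
rewrite esum_fset; last 2 first.
- exact: finite_finset.
- move=> p _; rewrite lee_fin mulr_ge0 // /uniform_homs.
  by case: ifP => _; rewrite ?invr_ge0.
rewrite fsbig_setT_fintype sumEFin; congr EFin.
rewrite natr_sum mulr_suml; apply: eq_bigr => p _.
rewrite /uniform_homs ifT; last by rewrite inE hr; exists p.
by rewrite cardE natrX mulrC.
Qed.

Lemma limn_esup_le_near (R : realType) (u : (\bar R)^nat) (l : \bar R) N :
  (forall n, (N < n)%N -> u n <= l)%E -> (limn_esup u <= l)%E.
Proof.
move=> ul; rewrite limn_esup_lim; apply: lime_le; first exact: is_cvg_esups.
exists N.+1 => // m /= Nm; apply: ge_ereal_sup => _ [k /= mk <-].
by apply: ul; exact: leq_trans mk.
Qed.

Lemma limn_esup_ge_freq (R : realType) (u : (\bar R)^nat) (l : \bar R) :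
  (forall N, exists2 n, (N < n)%N & l <= u n)%E -> (l <= limn_esup u)%E.
Proof.
move=> ul; rewrite limn_esup_lim; apply: lime_ge; first exact: is_cvg_esups.
apply: nearW => m; have [n mn ln] := ul m.
by apply: (le_trans ln); apply: ereal_sup_ubound; exists n => //=; exact: ltnW.
Qed.

Lemma rate_le (R : realType) (n : nat) (x a : R) : (0 < n)%N -> 0 <= x ->
  x <= expR (n%:R * a) -> ((n%:R^-1)%:E * lne x%:E <= a%:E)%E.
Proof.
move=> n0; rewrite le_eqVlt => /predU1P[<- _|x0 xa].
  by rewrite le0_lneNy // gt0_muleNy ?leNye // lte_fin invr_gt0 ltr0n.
rewrite lne_EFin // -EFinM lee_fin ler_pdivrMl ?ltr0n //.
by rewrite -ler_expR lnK // posrE.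
Qed.

Lemma rate_ge (R : realType) (n : nat) (x a : R) : (0 < n)%N ->
  expR (n%:R * a) <= x -> (a%:E <= (n%:R^-1)%:E * lne x%:E)%E.
Proof.
move=> n0 xa; have x0 : 0 < x := lt_le_trans (expR_gt0 _) xa.
rewrite lne_EFin // -EFinM lee_fin ler_pdivlMl ?ltr0n //.
by rewrite -ler_expR lnK // posrE.
Qed.

Lemma card_le_inj (I J : finType) (P : pred I) (Q : pred J) (f : I -> J) :
  {in P &, injective f} -> (forall i, P i -> Q (f i)) -> (#|P| <= #|Q|)%N.
Proof.
move=> inj PQ; rewrite -(card_in_imset inj); apply: subset_leq_card.
by apply/fintype.subsetP => _ /imsetP[i Pi ->]; exact: PQ.
Qed.

Lemma card_pair_pred (I J : finType) (P : pred (I * J)) :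
  #|P| = (\sum_i #|[pred j | P (i, j)]|)%N.
Proof.
rewrite -sum1_card big_mkcond /=.
rewrite (eq_bigr (fun p => if P (p.1, p.2) then 1 else 0)%N); last by case.
rewrite -(pair_bigA _ (fun i j => if P (i, j) then 1 else 0)%N) /=.
by apply: eq_bigr => i _; rewrite -big_mkcond sum1_card.
Qed.

Section Entropy.
Context (R : realType) (d : measure_display) (X : measurableType d) (mu : probability X R)
  (G : monoidType) (T : G -> X -> X) (A : finType) (phi : X -> A)
  (hT : mp_action mu T) (hphi : finite_observable phi)
  (r : nat) (r0 : (0 < r)%N) (s : 'I_r -> G) (S : set G) (hs : free_system s S).

Let B m : {fset G} := fset_set (word_ball S m).

Let Phi m : X -> {ffun B m -> A} := obs_name T phi (B m).

Let ballP m g : reflect (word_ball S m g) (g \in B m).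
Proof.
have fS : finite_set S by case: hs.
rewrite in_fset_set; last exact: word_ball_finite.
by apply: (iffP idP); rewrite inE.
Qed.

Let mPhi m : finite_observable (Phi m).
Proof. exact: obs_name_observable hT hphi _. Qed.

Definition ball_entropy m : R :=
  edge_entropy (law mu (Phi m)) (fun i => law mu (obs_edge T (Phi m) (s i))).

Lemma F_ball m :
  F_functional mu s T (ball_refinement S T [set phi @^-1` [set a] | a in [set: A]] m)
    = (ball_entropy m)%:E.
Proof.
have fS : finite_set S by case: hs.
rewrite ball_refinement_observable; last exact: word_ball_finite.
exact: (F_observable hT s (@mPhi m)).
Qed.

Lemma edge_law01 m i e : 0 <= law mu (obs_edge T (Phi m) (s i)) e <= 1.
Proof. by apply: law01; apply: (obs_edge_observable hT). Qed.

(** The window H is the ball with its translates by the generators: the name of x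
on H determines the names of x and of T_(s_i) x on the ball, that is, the edge
of x.  The map psi |-> psi^(B(e, m)) is injective because e is in the ball. *)
Lemma good_count_le m : exists H : {fset G}, forall n eps
    (hom : {ffun 'I_r -> 'S_n} -> G -> 'S_n),
  (forall p, sym_homs G n (hom p)) -> (forall p i, hom p (s i) = p i) ->
  (\sum_p good_count mu T phi H eps (hom p) <=
   #|near_models n (fun i => law mu (obs_edge T (Phi m) (s i))) eps|)%N.
Proof.
have fS : finite_set S by case: hs.
have fB := word_ball_finite m fS.
pose Hs := word_ball S m `|` [set (g * s i)%g | g in word_ball S m & i in [set: 'I_r]].
have fH : finite_set Hs.
  rewrite finite_setU; split => //; apply: finite_image2 => //; exact: finite_finset.
pose H := fset_set Hs.
have BH (b : B m) : val b \in H.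
  by rewrite in_fset_set // inE; left; apply/ballP; exact: valP.
have BsH i (b : B m) : (val b * s i)%g \in H.
  rewrite in_fset_set // inE; right; exists (val b); last by exists i.
  by apply/ballP; exact: valP.
exists H => n eps hom homP homs.
rewrite card_pair_pred; apply: leq_sum => p _.
have [s1 sM] := homP p.
pose emb (psi : {ffun 'I_n -> A}) : {ffun 'I_n -> {ffun B m -> A}} :=
  [ffun j => perm_name (hom p) psi (B m) j].
apply: (@card_le_inj _ _ _ _ emb) => [psi psi' _ _ e|psi].
  apply/ffunP => j; have B1 : 1%g \in B m by apply/ballP; exact: word_ball1.
  have /ffunP/(_ j) := e; rewrite !ffunE => /ffunP/(_ [` B1]%fset).
  by rewrite !ffunE /= s1.
rewrite !inE /= => hpsi; apply/forallP => i; apply/forallP => e.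
pose h (a : {ffun H -> A}) : {ffun B m -> A} * {ffun B m -> A} :=
  ([ffun b => a [` BH b]%fset], [ffun b => a [` BsH i b]%fset]).
have hQ x : h (obs_name T phi H x) = obs_edge T (Phi m) (s i) x.
  case: hT => _ TM _ _.
  by congr pair; apply/ffunP => b; rewrite !ffunE //= TM.
have hE j : h (perm_name (hom p) psi H j) = edge_label (emb psi) (p i) j.
  rewrite /edge_label !ffunE.
  by congr pair; apply/ffunP => b; rewrite !ffunE //= sM homs.
have dist : \sum_e `|law mu (obs_edge T (Phi m) (s i)) e -
    (fiber_card (edge_label (emb psi) (p i)) e)%:R / n%:R| <= eps.
  apply: le_trans hpsi; rewrite /name_dist.
  apply: (@pushforward_dist R _ _ h (fun a => law mu (obs_name T phi H) a)
    (fun a => (fiber_card (perm_name (hom p) psi H) a)%:R / n%:R)) => c.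
    by apply: law_sum => //; exact: obs_name_observable hT hphi _.
  rewrite -mulr_suml -natr_sum -fiber_card_comp; congr (_%:R / _).
  by apply: eq_fiber_card => j; rewrite /= hE.
rewrite distrC; apply: le_trans dist; rewrite (bigD1 e) //= lerDl.
by rewrite sumr_ge0.
Qed.

(** Every Psi with edge counts W is the ball name of psi(j) = Psi(j)(e), because
the edges of Psi occur among those of actual points of X. *)
Lemma edge_models_le m (H : {fset G}) : (forall g, g \in H -> g \in B m) ->
  forall eps n (hom : {ffun 'I_r -> 'S_n} -> G -> 'S_n)
    (W : 'I_r -> {ffun B m -> A} * {ffun B m -> A} -> nat) (k : {ffun B m -> A} -> nat),
  (forall p, sym_homs G n (hom p)) -> (forall p i, hom p (s i) = p i) ->
  (forall i c, (\sum_(e | e.1 == c) W i e)%N = k c) ->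
  (forall i e, law mu (obs_edge T (Phi m) (s i)) e = 0 -> W i e = 0%N) ->
  \sum_c `|law mu (Phi m) c - (k c)%:R / n%:R| <= eps ->
  (#|edge_models n W| <= \sum_p good_count mu T phi H eps (hom p))%N.
Proof.
move=> HB eps n hom W k homP homs W1 W0 kdist.
rewrite card_pair_pred; apply: leq_sum => p _.
have [s1 sM] := homP p.
have B1 : 1%g \in B m by apply/ballP; exact: word_ball1.
pose base (Psi : {ffun 'I_n -> {ffun B m -> A}}) : {ffun 'I_n -> A} :=
  [ffun j => Psi j [` B1]%fset].
have key (Psi : {ffun 'I_n -> {ffun B m -> A}}) : edge_models n W (p, Psi) ->
    forall j, Psi j = perm_name (hom p) (base Psi) (B m) j.
  move=> /forallP PW.
  (* The edge of j has positive count, hence positive probability, hence is the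
     edge of some point x. *)
  have consist i j g (gB : g \in B m) (gsB : (g * s i)%g \in B m) :
      Psi (p i j) [` gB]%fset = Psi j [` gsB]%fset.
    have [x [x1 x2]] : exists x, Phi m x = Psi j /\ Phi m (T (s i) x) = Psi (p i j).
      apply: contrapT => nx.
      have /forallP/(_ (Psi j, Psi (p i j)))/eqP/= := PW i.
      rewrite W0; last first.
        rewrite /law (_ : _ @^-1` _ = set0) ?measure0 //.
        apply/seteqP; split => x //=; rewrite /obs_edge => -[e1 e2].
        by apply: nx; exists x.
      move/eqP; rewrite /fiber_card => /eqP/card0_eq/(_ j).
      by rewrite !inE /edge_label eqxx.
    by rewrite -x1 -x2 !ffunE /=; case: hT => _ -> _ _.
  have main m' : (m' <= m)%N -> forall g (gB : g \in B m), word_ball S m' g ->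
      forall j, Psi j [` gB]%fset = base Psi (hom p g j).
    have base1 g (gB : g \in B m) j : g = 1%g -> Psi j [` gB]%fset = base Psi (hom p g j).
      move=> g1; move: gB; rewrite g1 => gB; rewrite s1 ffunE.
      by congr (Psi j _); exact/val_inj.
    elim: m' => [|m' IH] mm g gB.
      by move/word_ball0 => g1 j; exact: base1.
    case/word_ballS => [g1 j|[g' [x [Bg' Sx gE]]] j]; first exact: base1.
    have mm' : (m' <= m)%N := ltnW mm.
    have g'B : g' \in B m by apply/ballP; exact: (word_ball_mono mm').
    have [_ _ _ _ /(_ x Sx)[i [xi|xi]]] := hs.
      have gsB : (g' * s i)%g \in B m by rewrite -xi -gE.
      have -> : Psi j [` gB]%fset = Psi j [` gsB]%fset.
        by congr (Psi j _); apply/val_inj; rewrite /= gE xi.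
      by rewrite -(consist i j g' g'B) (IH mm') // gE xi sM homs.
    have gs : (g * s i)%g = g' by rewrite gE -mulgA xi mulg1.
    have gsB : (g * s i)%g \in B m by rewrite gs.
    (* Here g s_i = g', so that the edge is followed backwards from j. *)
    pose j' := (p i)^-1%g j.
    have jE : p i j' = j by rewrite /j' permKV.
    rewrite -{1 2}jE (consist i j' g gB gsB).
    have -> : Psi j' [` gsB]%fset = Psi j' [` g'B]%fset.
      by congr (Psi j' _); apply/val_inj.
    by rewrite (IH mm') // -gs sM homs.
  move=> j; apply/ffunP => b; rewrite [RHS]ffunE.
  have := main m (leqnn m) (val b) (valP b) _ j.
  rewrite (_ : [` valP b]%fset = b); last exact/val_inj.
  by apply; apply/ballP; exact: valP.
apply: (@card_le_inj _ _ _ _ base) => [Psi Psi'|Psi].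
  rewrite !unfold_in /= => PW PW' e; apply/ffunP => j.
  by rewrite (key _ PW) (key _ PW') e.
move=> PW; rewrite inE /=; apply: le_trans kdist; rewrite /name_dist.
pose h (a : {ffun B m -> A}) : {ffun H -> A} :=
  [ffun b => a [` HB (val b) (valP b)]%fset].
have kE c : k c = fiber_card Psi c.
  rewrite -(W1 (Ordinal r0)) -(edge_label_src Psi (p (Ordinal r0))).
  apply: eq_bigr => e _; apply/esym/eqP.
  by move/forallP: (PW) => /(_ (Ordinal r0))/forallP/(_ e).
apply: (@pushforward_dist R _ _ h) => a.
  apply: law_sum => // x; apply/ffunP => b; by rewrite !ffunE.
rewrite -mulr_suml -natr_sum; congr (_%:R / _).
rewrite (eq_bigr (fiber_card Psi)) // -fiber_card_comp.
by apply: eq_fiber_card => j; rewrite /= (key _ PW); apply/ffunP => b; rewrite !ffunE.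
Qed.

Lemma Sigma_entropy_le m :
  (Sigma_entropy mu (uniform_homs R G) T phi <= (ball_entropy m)%:E)%E.
Proof.
apply/lee_addgt0Pr => delta d0; rewrite -EFinD.
have [H HP] := good_count_le m.
have [|i e|i c|eps [N [e0 HN]]] := near_models_upper r0 d0 (p := law mu (Phi m))
    (P := fun i => law mu (obs_edge T (Phi m) (s i))).
- by move=> c; exact: law01.
- exact: edge_law01.
- exact: (law_edge_src hT _ _ (@mPhi m)).
apply: le_trans (ereal_inf_lbound _) _; first by exists H.
apply: le_trans (ereal_inf_lbound _) _; first by exists eps.
apply: (@limn_esup_le_near _ _ _ N) => n Nn.
have [hom [homP homs homr]] := free_system_homs n hs.
rewrite (esum_uniform_homs _ _ homs homr).
apply: rate_le; first exact: leq_ltn_trans Nn.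
  by rewrite divr_ge0 // exprn_ge0.
apply: le_trans (HN n Nn); rewrite ler_wpM2r ?invr_ge0 ?exprn_ge0 //.
by rewrite ler_nat HP.
Qed.

Lemma f_invariant_le :
  (f_invariant mu s S T phi <= Sigma_entropy mu (uniform_homs R G) T phi)%E.
Proof.
apply: le_ereal_inf_tmp => _ [H _ <-]; apply: le_ereal_inf_tmp => _ [eps e0 <-].
have [m Hm] := free_system_exhaust H hs.
have HB g : g \in H -> g \in B m by move=> gH; apply/ballP; exact: Hm.
apply: le_trans (ereal_inf_lbound _) _; first by exists m.
rewrite F_ball; apply/lee_subgt0Pr => delta d0; rewrite -EFinB.
apply: limn_esup_ge_freq => N.
pose C := {ffun B m -> A}.
(* The tolerance per name is such that the sum over all names is below eps. *)
pose eps' := eps / (#|{: C}|%:R + 1).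
have C1 : 0 < #|{: C}|%:R + 1 :> R by rewrite ltr_wpDl.
have e'0 : 0 < eps' by rewrite divr_gt0.
have [|i e|||i c|n [W [k [Nn W1 W0 kp cnt]]]] := edge_models_lower N r0 d0 e'0
    (p := law mu (Phi m)) (P := fun i => law mu (obs_edge T (Phi m) (s i))).
- by move=> c; exact: law01.
- exact: edge_law01.
- exact: law_total.
- by move=> i c; exact: (law_edge_src hT _ _ (@mPhi m)).
- exact: (law_edge_tgt hT _ _ (@mPhi m)).
exists n => //.
have [hom [homP homs homr]] := free_system_homs n hs.
rewrite (esum_uniform_homs _ _ homs homr).
apply: rate_ge; first exact: leq_ltn_trans Nn.
apply: le_trans cnt _; rewrite ler_wpM2r ?invr_ge0 ?exprn_ge0 // ler_nat.
apply: (edge_models_le HB homP homs W1 W0).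
apply: le_trans (_ : #|{: C}|%:R * eps' <= _).
  apply: le_trans (ler_norm _) _; apply: ler_norm_sum_const => [|c _]; first exact: ltW.
  by rewrite normr_id distrC.
rewrite /eps' mulrCA ger_pMr // ler_pdivrMr // mul1r lerDl //.
Qed.

Lemma Sigma_entropy_eq :
  Sigma_entropy mu (uniform_homs R G) T phi = f_invariant mu s S T phi.
Proof.
apply/eqP; rewrite eq_le f_invariant_le andbT.
apply: le_ereal_inf_tmp => _ [m _ <-]; rewrite F_ball.
exact: Sigma_entropy_le.
Qed.

End Entropy.

Theorem theorem1p3 (R : realType) (r : nat) (hr : (1 <= r)%N)
    (d : measure_display) (X : measurableType d) (mu : probability X R)
    (hX : standard_probability_space mu)
    (A : finType) (phi : X -> A) (hphi : finite_observable phi) :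
  (forall (G : groupType) (s : 'I_r -> G) (T : G -> X -> X),
     free_group_on s -> mp_action mu T ->
     Sigma_entropy mu (uniform_homs R G) T phi
       = f_invariant mu s (group_generators s) T phi)
  /\
  (forall (G : monoidType) (s : 'I_r -> G) (T : G -> X -> X),
     free_semigroup_on s -> mp_action mu T ->
     Sigma_entropy mu (uniform_homs R G) T phi
       = f_invariant mu s (semigroup_generators s) T phi).
Proof.
split => G s T hs hT.
  exact: (Sigma_entropy_eq hT hphi hr (free_group_system hs)).
exact: (Sigma_entropy_eq hT hphi hr (free_semigroup_system hs)).
Qed.
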